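(* Let $N\ge1$, and let $V$, $\Delta$, $\mathcal F$, $\mathcal W$ and $\mathcal H_\Omega$ be as in the context. Define the measure $\mu_{c+p}$ on $[-1,1]$ by $$d\mu_{c+p}=\frac{\frac{2}{\pi}\sqrt{1-x^2}}{1-2N^{-1/2}x+N^{-1}}\,dx.$$ Then the restriction of $\mathcal W\Delta\mathcal W^*$ to $\mathcal H_\Omega$ is unitarily equivalent to the operator of multiplication by $N+1-2\sqrt N x$ on $L^2(\mu_{c+p})$.
   Context: $V$ is the set of finite words over $\{1,\dots,N\}$ including the empty word $\emptyset$; the $N$-ary tree has edges exactly the pairs $\{\omega,\omega i\}$ ($\omega i$ is $\omega$ with the letter $i$ appended). $\Delta$ is the graph Laplacian $(\Delta v)(x)=\sum_{y\sim x}(v(x)-v(y))$ on $l^2(V)$ (bounded selfadjoint). Let $H=\mathbb{C}^N$ with orthonormal basis $e_1,\dots,e_N$ and $\mathcal F=\mathbb{C}\Omega\oplus H\oplus H^{\otimes2}\oplus\cdots$ the full Fock space ($\Omega$ a unit vector). $\mathcal W:l^2(V)\to\mathcal F$ is the unitary with $\mathcal W\delta_\emptyset=\Omega$, $\mathcal W\delta_{\omega_1\dots\omega_n}=e_{\omega_1}\otimes\cdots\otimes e_{\omega_n}$. Let $s_0=N^{-1/2}\sum_{i=1}^Ne_i$ and $\mathcal H_\Omega=\overline{\operatorname{span}}\{\Omega,\ s_0^{\otimes p}:p\ge1\}$. *)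

(* Defs.v *)
From HB Require Import structures.
From mathcomp Require Import all_boot all_order all_algebra.
From mathcomp Require Import all_classical all_reals all_analysis.
From mathcomp Require Import complex.
Set Implicit Arguments. Unset Strict Implicit. Unset Printing Implicit Defensive.
Import Order.TTheory GRing.Theory Num.Theory.
Local Open Scope ring_scope.
Local Open Scope classical_set_scope.

Section Defs.
Variables (R : realType) (N : nat).

Definition C := R[i].
Definition csq (z : C) : R := (complex.Re z) ^+ 2 + (complex.Im z) ^+ 2.

(* Vertices of the N-ary tree: finite words over the alphabet 'I_N
   (letter i : 'I_N stands for the letter i+1 of {1,...,N}).
   The word omega i (i appended) is [rcons omega i]. *)
Definition word := seq 'I_N.

(* Vectors of l^2(V) (equivalently, via the unitary W, of the full Fock
   space, whose ONB is e_{w1} (x) ... (x) e_{wn}, indexed by words) are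
   functions word -> C. *)
Definition vec := word -> C.

Definition lvl_sq (v : vec) (n : nat) : R :=
  \sum_(t : n.-tuple 'I_N) csq (v (tval t)).

Definition l2sq (v : vec) : \bar R := \sum_(0 <= n <oo) ((lvl_sq v n)%:E).

Definition in_l2 (v : vec) : Prop := (l2sq v < +oo)%E.

Definition parent (w : word) : word := take (size w).-1 w.

(* graph Laplacian (Delta v)(x) = sum_{y ~ x} (v x - v y);
   neighbours of w: its children rcons w i, and its parent if w <> [::] *)
Definition lap (v : vec) : vec := fun w =>
  \sum_(i < N) (v w - v (rcons w i))
  + (if w is [::] then 0 else v w - v (parent w)).

(* the vector s_0^{(x) p} (with s_0^{(x)0} = Omega) in coordinates:
   N^{-p/2} on each word of length p, 0 elsewhere *)
Definition s0pow (p : nat) : vec := fun w =>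
  if size w == p then real_complex R ((Num.sqrt (N%:R : R))^-p) else 0.

Definition span_elt (n : nat) (c : nat -> C) : vec := fun w =>
  \sum_(p < n) c p * s0pow p w.

Definition in_HOmega (v : vec) : Prop :=
  in_l2 v /\
  forall eps : R, 0 < eps -> exists n c,
    (l2sq (fun w => (v w - span_elt n c w)%R) < eps%:E)%E.

Definition rho (x : R) : R :=
  (2 / pi * Num.sqrt (1 - x ^+ 2)) /
  (1 - 2 * (Num.sqrt (N%:R : R))^-1 * x + (N%:R)^-1).

Definition L2sq (f : R -> C) : \bar R :=
  (\int[lebesgue_measure]_(x in `[(-1 : R)%R, 1%R]) ((csq (f x) * rho x)%R%:E))%E.

Definition in_L2 (f : R -> C) : Prop :=
  measurable_fun `[(-1 : R)%R, 1%R] (fun x => complex.Re (f x)) /\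
  measurable_fun `[(-1 : R)%R, 1%R] (fun x => complex.Im (f x)) /\
  (L2sq f < +oo)%E.

Definition L2eq (f g : R -> C) : Prop := L2sq (fun x => f x - g x) = 0%E.

Definition mulop (f : R -> C) : R -> C := fun x =>
  real_complex R (N%:R + 1 - 2 * Num.sqrt (N%:R : R) * x) * f x.

End Defs.

(* Main.v *)
Require Import Defs.
From HB Require Import structures.
From mathcomp Require Import all_boot all_order all_algebra.
From mathcomp Require Import all_classical all_reals all_analysis.
From mathcomp Require Import complex.
From mathcomp Require Import measurable_realfun ring lra.
Set Implicit Arguments. Unset Strict Implicit. Unset Printing Implicit Defensive.
Import Order.TTheory GRing.Theory Num.Theory.
Import numFieldNormedType.Exports.
Local Open Scope ring_scope.
Local Open Scope classical_set_scope.

(** H_Omega consists of the radial square-summable vectors, with orthonormal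
    basis s_0^p, and in this basis (N + 1 - Delta) / (2 sqrt N) is the Jacobi
    operator of the polynomials P_n = U_n - N^(-1/2) U_(n-1), where U_n are the
    Chebyshev polynomials of the second kind. By the symmetry of the recurrence,
    the P_n are orthonormal for rho as soon as the integral of P_n rho is
    delta_(n,0). Writing r = N^(-1/2) and b_n for that integral, multiplying by
    the denominator of rho reduces to the semicircle law and gives
    b_n - r b_(n+1) = delta_(n,0); for r < 1 boundedness of b_n forces b_1 = 0,
    and r = 1 (N = 1, where rho is unbounded) follows by letting r tend to 1.

    The P_n sqrt(rho) are total in L^2[-1,1]: the polynomials (1 - y^n)^(2^n), y
    affine in x, tend boundedly to indicators of half-lines, so a function
    orthogonal to all polynomials has a vanishing primitive. Riesz-Fischer
    sends s_0^p to P_p; by totality an L^2 function is determined by its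
    coefficients, and linearity, surjectivity and the intertwining relation
    become identities between coefficients. *)

(** * Square-integrable functions and the Riesz-Fischer theorem *)

Section SquareIntegrable.
Context d (T : measurableType d) (R : realType).
Variables (mu : {measure set T -> \bar R}) (D : set T).
Hypothesis mD : measurable D.
Implicit Types (f g h : T -> R) (a : R).

Definition sqint f :=
  measurable_fun D f /\ mu.-integrable D (EFin \o (fun x => f x ^+ 2)).

Definition ip f g : R := \int[mu]_(x in D) (f x * g x).

Lemma sqintM f g : sqint f -> sqint g ->
  mu.-integrable D (EFin \o (fun x => f x * g x)).
Proof.
move=> [mf f2] [mg g2].
apply: (@le_integrable _ _ _ mu D mD _
  (EFin \o (fun x => f x ^+ 2 + g x ^+ 2))).
- by apply/measurable_EFinP; exact: measurable_funM.
- move=> x _ /=; rewrite lee_fin normrM.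
  rewrite (ger0_norm (addr_ge0 (sqr_ge0 _) (sqr_ge0 _))).
  rewrite -(real_normK (num_real (f x))) -(real_normK (num_real (g x))).
  by nra.
- exact: (integrableD mD f2 g2).
Qed.

Lemma sqint_lin a f g : sqint f -> sqint g -> sqint (fun x => a * f x + g x).
Proof.
move=> sf sg; have fg := sqintM sf sg; case: sf sg => [mf f2] [mg g2]; split.
  by apply: measurable_funD => //; exact: measurable_funM.
apply: (@eq_integrable _ _ _ mu D mD ((fun x => ((a ^+ 2)%:E * (f x ^+ 2)%:E) +
  (((2 * a)%:E * (f x * g x)%:E) + (g x ^+ 2)%:E))%E)).
  by move=> x _ /=; rewrite -!EFinM -!EFinD; congr EFin; ring.
apply: integrableD => //; first exact: (integrableZl mD _ f2).
by apply: integrableD => //; exact: (integrableZl mD _ fg).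
Qed.

Lemma sqint0 : sqint (fun=> 0).
Proof.
split; first exact: measurable_cst.
apply: (@eq_integrable _ _ _ mu D mD (cst 0%E)); last exact: integrable0.
by move=> x _ /=; rewrite expr0n.
Qed.

Lemma sqintZ a f : sqint f -> sqint (fun x => a * f x).
Proof.
move=> sf; have := sqint_lin a sf sqint0.
by congr sqint; apply/funext => x; rewrite addr0.
Qed.

Lemma sqintD f g : sqint f -> sqint g -> sqint (fun x => f x + g x).
Proof.
move=> sf sg; have := sqint_lin 1 sf sg.
by congr sqint; apply/funext => x; rewrite mul1r.
Qed.

Lemma sqintB f g : sqint f -> sqint g -> sqint (fun x => f x - g x).
Proof.
move=> sf sg; have := sqint_lin (-1) sg sf.
by congr sqint; apply/funext => x; rewrite mulN1r addrC.
Qed.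

Lemma ipC f g : ip f g = ip g f.
Proof. by apply: eq_Rintegral => x _; rewrite mulrC. Qed.

Lemma ip_lin a f g h : sqint f -> sqint g -> sqint h ->
  ip (fun x => a * f x + g x) h = a * ip f h + ip g h.
Proof.
move=> sf sg sh; have fh := sqintM sf sh; have gh := sqintM sg sh.
rewrite /ip -RintegralZl// -RintegralD//.
  by apply: eq_Rintegral => x _; ring.
exact: (integrableZl mD a fh).
Qed.

Lemma ip0l h : ip (fun=> 0) h = 0.
Proof.
rewrite /ip (eq_Rintegral mu (g := fun=> 0)) => [|x _]; last by rewrite mul0r.
by rewrite /Rintegral integral0.
Qed.

Lemma ipZ a f h : sqint f -> sqint h -> ip (fun x => a * f x) h = a * ip f h.
Proof.
move=> sf sh; have := ip_lin a sf sqint0 sh; rewrite ip0l addr0 => <-.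
by congr ip; apply/funext => x; rewrite addr0.
Qed.

Lemma ipD f g h : sqint f -> sqint g -> sqint h ->
  ip (fun x => f x + g x) h = ip f h + ip g h.
Proof.
move=> sf sg sh; have := ip_lin 1 sf sg sh; rewrite mul1r => <-.
by congr ip; apply/funext => x; rewrite mul1r.
Qed.

Lemma ipB f g h : sqint f -> sqint g -> sqint h ->
  ip (fun x => f x - g x) h = ip f h - ip g h.
Proof.
move=> sf sg sh; have := ip_lin (-1) sg sf sh; rewrite mulN1r addrC => <-.
by congr ip; apply/funext => x; rewrite mulN1r addrC.
Qed.

Lemma ip_ge0 f : 0 <= ip f f.
Proof. by apply: Rintegral_ge0 => x _; rewrite -expr2 sqr_ge0. Qed.

Lemma ip_integral f : sqint f ->
  (\int[mu]_(x in D) (f x ^+ 2)%:E = (ip f f)%:E)%E.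
Proof.
move=> [mf f2]; rewrite /ip /Rintegral fineK; last first.
  rewrite (_ : (fun x => _) = (EFin \o (fun x => f x ^+ 2)))//.
  exact: integrable_fin_num.
by apply: eq_integral.
Qed.

(** * Orthonormal families and Bessel's inequality *)

Variable phi : nat -> T -> R.
Definition orthonormal :=
  (forall n, sqint (phi n)) /\ (forall m n, ip (phi m) (phi n) = (m == n)%:R).

Hypothesis on : orthonormal.

Definition fsum (c : nat -> R) n : T -> R := fun x => \sum_(i < n) c i * phi i x.

Lemma fsumS c n : fsum c n.+1 = (fun x => c n * phi n x + fsum c n x).
Proof. by apply/funext => x; rewrite /fsum big_ord_recr /= addrC. Qed.

Lemma fsum0 c : fsum c 0 = (fun=> 0).
Proof. by apply/funext => x; rewrite /fsum big_ord0. Qed.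

Lemma sqint_fsum c n : sqint (fsum c n).
Proof.
elim: n => [|n ih]; first by rewrite fsum0; exact: sqint0.
by rewrite fsumS; apply: sqint_lin => //; exact: on.1.
Qed.

Lemma ip_fsum c n h : sqint h ->
  ip (fsum c n) h = \sum_(i < n) c i * ip (phi i) h.
Proof.
move=> sh; elim: n => [|n ih]; first by rewrite fsum0 ip0l big_ord0.
by rewrite fsumS ip_lin ?ih ?big_ord_recr 1?addrC//; [exact: on.1|exact: sqint_fsum].
Qed.

Lemma ip_fsum_phi c n i : ip (fsum c n) (phi i) = if (i < n)%N then c i else 0.
Proof.
rewrite ip_fsum; last exact: on.1.
under eq_bigr do rewrite on.2.
case: ltnP => [ltin|leni].
  rewrite (bigD1 (Ordinal ltin)) //= eqxx mulr1 big1 ?addr0 // => j ji.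
  by rewrite (_ : (_ == _) = false) ?mulr0//; apply/negbTE.
rewrite big1// => j _; rewrite (_ : (_ == _) = false) ?mulr0//.
by apply/negbTE; rewrite neq_ltn (leq_trans (ltn_ord j) leni).
Qed.

(** Pythagoras for the projection [fsum c n] of [f]. The coefficients need to agree with [c] only
    below [n], so [f] may itself be a longer partial sum of the same series. *)
Lemma bessel_eq c n f : sqint f -> (forall i, (i < n)%N -> ip f (phi i) = c i) ->
  ip (fun x => f x - fsum c n x) (fun x => f x - fsum c n x) =
  ip f f - \sum_(i < n) c i ^+ 2.
Proof.
move=> sf fc; have sS := sqint_fsum c n.
have e : ip f (fsum c n) = \sum_(i < n) c i ^+ 2.
  rewrite ipC ip_fsum//; apply: eq_bigr => i _.
  by rewrite ipC fc// expr2.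
have e2 : ip (fsum c n) (fsum c n) = \sum_(i < n) c i ^+ 2.
  rewrite ip_fsum//; apply: eq_bigr => i _.
  by rewrite ipC ip_fsum_phi ltn_ord expr2.
rewrite ipB//; last exact: sqintB.
rewrite ![ip _ (fun x => f x - _)]ipC !ipB//.
by rewrite e2 [ip (fsum _ _) _]ipC e; ring.
Qed.

Lemma bessel n f : sqint f -> \sum_(i < n) ip f (phi i) ^+ 2 <= ip f f.
Proof.
move=> sf; have := @bessel_eq (fun i => ip f (phi i)) n f sf (fun _ _ => erefl).
by move/(congr1 (fun x => 0 <= x)); rewrite ip_ge0 subr_ge0 => <-.
Qed.

End SquareIntegrable.

(** * The Riesz-Fischer theorem for a finite measure *)

Section RieszFischer.
Context d (T : measurableType d) (R : realType).
Variables (mu : {measure set T -> \bar R}) (D : set T).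
Hypothesis mD : measurable D.
Hypothesis muD : (mu D < +oo)%E.
Variable phi : nat -> T -> R.
Hypothesis on : orthonormal mu D phi.
Variable c : nat -> R.
Let s n := \sum_(i < n) c i ^+ 2.
Variable l : R.
Hypothesis sl : s @ \oo --> l.
Let S := fsum phi c.

Let ss m n : ip mu D (fun x => S m x - S n x) (fun x => S m x - S n x)
  = `|s m - s n|.
Proof.
wlog nm : m n / (n <= m)%N => [hw|].
  have [nm|/ltnW mn] := leqP n m; first exact: hw.
  rewrite distrC -hw//; apply: eq_Rintegral => x _; ring.
have sS k : sqint mu D (S k) := sqint_fsum mD on c k.
rewrite (bessel_eq mD on) => //; last first.
  by move=> i lin; rewrite ip_fsum_phi// (leq_trans lin nm).
(* At [f := S m] the remainder is zero, which gives the squared norm [s m]. *)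
have := bessel_eq mD on (sS m) (c := c) (n := m).
rewrite (_ : ip _ _ _ _ = 0) => [e|]; last first.
  rewrite /ip (eq_Rintegral mu (g := fun=> 0)); last first.
    by move=> x _; rewrite subrr mul0r.
  by rewrite /Rintegral integral0.
have {}e : ip mu D (S m) (S m) = s m.
  apply/eqP; rewrite -subr_eq0 -e//.
  by move=> i lim; rewrite ip_fsum_phi// lim.
rewrite e ger0_norm// subr_ge0 /s -!(big_mkord xpredT (fun i => c i ^+ 2)).
rewrite [leRHS](big_cat_nat _ nm)//= lerDl.
by apply: sumr_ge0 => i _; exact: sqr_ge0.
Qed.

Let s_le n : s n <= l.
Proof.
have nd : nondecreasing_seq s.
  apply/nondecreasing_seqP => k; rewrite /s big_ord_recr/= lerDl.
  exact: sqr_ge0.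
have cs : cvgn s by apply/cvg_ex; exists l.
by have := nondecreasing_cvgn_le nd cs n; rewrite (cvg_lim _ sl).
Qed.

(** Along this subsequence the increments have L^2 norm at most 2^-k. As the measure is finite,
    their L^1 norms are summable too, which gives convergence almost everywhere. *)
Let fast : {N : nat -> nat | forall k, l - s (N k) <= (4 ^- k)}.
Proof.
suff H k : {n | l - s n <= 4 ^- k} by exists (fun k => sval (H k)) => k; case: (H k).
apply: cid; have e0 : 0 < (4 ^- k : R) by rewrite invr_gt0 exprn_gt0.
move/cvgrPdist_le : sl => /(_ _ e0)[n _ H]; exists n.
by apply: le_trans (H n (leqnn n)); exact: ler_norm.
Qed.

Let N := sval fast.
Let NP k : l - s (N k) <= 4 ^- k. Proof. exact: (svalP fast). Qed.
Let dd k x := S (N k.+1) x - S (N k) x.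

Let sqS k : sqint mu D (S k). Proof. exact: (sqint_fsum mD on). Qed.

Let sqdd k : sqint mu D (dd k). Proof. by apply: sqintB. Qed.

Let dd2 k : ip mu D (dd k) (dd k) <= 4 ^- k.
Proof.
rewrite /dd ss; have h1 := NP k; have h2 := NP k.+1.
have h3 := s_le (N k); have h4 := s_le (N k.+1).
have h5 : (4 ^- k.+1 : R) <= 4 ^- k.
  by rewrite -exprVn exprS exprVn ler_piMl ?invr_ge0 ?exprn_ge0//; lra.
by rewrite ler_norml; apply/andP; split; lra.
Qed.

Let M := 1 + fine (mu D).

Let int_dd k : (\int[mu]_(x in D) `|dd k x|%:E <= (2 ^- k * M)%:E)%E.
Proof.
have [mdd idd] := sqdd k.
have p2 : 0 < (2 ^+ k : R) by rewrite exprn_gt0.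
have mf : mu D \is a fin_num by rewrite ge0_fin_numE.
(* AM-GM: |d| <= 2^k d^2 + 2^-k *)
apply: (@le_trans _ _ (\int[mu]_(x in D)
    ((2 ^+ k)%:E * (dd k x ^+ 2)%:E + (2 ^- k)%:E))%E).
  apply: ge0_le_integral => //.
  - by apply/measurable_EFinP; exact: measurableT_comp.
  - apply: emeasurable_funD; last exact: measurable_cst.
    exact: measurable_funeM (measurable_int _ idd).
  - move=> x _; rewrite -EFinM -EFinD lee_fin.
    rewrite -(real_normK (num_real (dd k x))).
    set y := `|_|; set t := 2 ^+ k in p2 *.
    rewrite -(ler_pM2l p2) mulrDr divff ?gt_eqF//.
    by have := sqr_ge0 (t * y - 1); rewrite !expr2; nra.
rewrite integralD//; last 2 first.
- exact: integrableZl idd.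
- apply/integrableP; split; first exact: measurable_cst.
  rewrite integral_cst//= lte_mul_pinfty//.
rewrite integralZl// integral_cst//= ip_integral//.
rewrite -(fineK mf) -!EFinM -EFinD lee_fin /M mulrDr mulr1 lerD2r.
have := dd2 k; rewrite -[4]/(2 * 2)%:R natrM exprMn invfM => h.
by rewrite mulrC -ler_pdivlMr//.
Qed.

Let sum_dd : (\int[mu]_(x in D) (\sum_(k <oo) `|dd k x|%:E) < +oo)%E.
Proof.
have M0 : 0 <= M by rewrite addr_ge0// fine_ge0.
rewrite integral_nneseries//; last first.
  move=> n; apply/measurable_EFinP; apply: measurableT_comp => //.
  by case: (sqdd n).
apply: (@le_lt_trans _ _ (\sum_(k <oo) (2 ^- k * M)%:E)%E).
  by apply: lee_nneseries => [k _ _|k _]; [exact: integral_ge0|exact: int_dd].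
have hc : cvgn (series (geometric M (2^-1 : R))).
  by apply: is_cvg_geometric_series; rewrite ger0_norm; lra.
rewrite [ltLHS](_ : _ = (limn (series (geometric M (2^-1 : R))))%:E) ?ltry//.
rewrite -EFin_lim//; congr (limn _); apply/funext => n /=.
rewrite /series /= -sumEFin; apply: eq_bigr => k _.
by rewrite exprVn mulrC.
Qed.

(** An upper limit is measurable before any convergence is known, and it equals the limit wherever a
    finite one exists; [fine] gives a default value where it is infinite. *)
Let f x := fine (limn_esup (fun k => (S (N k) x)%:E)).

Let mf : measurable_fun D f.
Proof.
apply: measurableT_comp => //; apply: measurable_fun_limn_esup => k.
by apply/measurable_EFinP; case: (sqS (N k)).
Qed.

(** By [sum_dd] the series of the |dd k x| is finite almost everywhere, so the telescoping series of
    the [dd k x] converges absolutely there. *)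
Let cvg_f : {ae mu, forall x, D x -> (fun k => S (N k) x) @ \oo --> f x}.
Proof.
have : mu.-integrable D (fun x => \sum_(k <oo) `|dd k x|%:E)%E.
  apply/integrableP; split.
    apply: ge0_emeasurable_sum => // k _.
    by apply/measurable_EFinP; apply: measurableT_comp => //; case: (sqdd k).
  under eq_integral => x _ do rewrite gee0_abs ?nneseries_ge0//.
  exact: sum_dd.
move/(integrable_ae mD); apply: filterS => x /[apply] fin.
suff : cvgn (fun k => S (N k) x).
  move=> /cvg_ex[y Hy]; rewrite /f.
  rewrite (_ : limn_esup _ = y%:E)//.
  have Ey : (fun k => (S (N k) x)%:E) @ \oo --> y%:E.
    by apply: cvg_EFin => //; exact: nearW.
  by rewrite is_cvg_limn_esupE; [exact: cvg_lim|apply/cvg_ex; exists y%:E].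
have : cvgn (series (fun k => dd k x)).
  apply: normed_cvg; apply: nondecreasing_is_cvgn.
    by apply: (@nondecreasing_series _ (fun k => `|dd k x|) xpredT 0).
  exists (fine (\sum_(k <oo) `|dd k x|%:E)) => _ [n _ <-].
  rewrite -lee_fin fineK// /series /= -sumEFin.
  exact: nneseries_lim_ge.
move=> cv; have -> : (fun k => S (N k) x) =
    (fun k => series (fun k => dd k x) k + S (N 0) x).
  apply/funext => k; rewrite /series/= /dd (telescope_sumr (fun i => S (N i) x))//.
  by rewrite subrK.
by apply: is_cvgD => //; exact: is_cvg_cst.
Qed.

(** Fatou's lemma along the subsequence: the integral of [h k] is |s (N k) - s n| by [ss] and tends
    to [l - s n], for arbitrary [n]. *)
Let fatou_f n : (\int[mu]_(x in D) ((f x - S n x) ^+ 2)%:E <= (l - s n)%:E)%E.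
Proof.
pose h k x := ((S (N k) x - S n x) ^+ 2)%:E.
have mh k : measurable_fun D (h k).
  apply/measurable_EFinP/measurable_funX/measurable_funB.
    by case: (sqS (N k)). by case: (sqS n).
apply: (@le_trans _ _ (\int[mu]_(x in D) limn_einf (h ^~ x))%E).
  rewrite (ge0_ae_eq_integral (g := fun x => limn_einf (h ^~ x)))//.
  - apply/measurable_EFinP/measurable_funX/measurable_funB => //.
    by case: (sqS n).
  - under eq_fun do rewrite -[limn_einf _]oppeK -limn_esupN.
    apply: measurableT_comp => //; apply: measurable_fun_limn_esup => k.
    exact: measurableT_comp.
  - by move=> x _; rewrite lee_fin sqr_ge0.
  - move=> x _; rewrite limn_einf_lim; apply: lime_ge; first exact: is_cvg_einfs.
    apply: nearW => k; apply: le_ereal_inf_tmp => _ [j _ <-].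
    by rewrite lee_fin sqr_ge0.
  - apply: filterS cvg_f => x /[apply] cf.
    have : h ^~ x @ \oo --> ((f x - S n x) ^+ 2)%:E.
      apply: cvg_EFin; first exact: nearW.
      rewrite /comp/= expr2; under eq_fun do rewrite expr2.
      by apply: cvgM; (apply: cvgB => //; exact: cvg_cst).
    move=> hc; rewrite is_cvg_limn_einfE; last by apply/cvg_ex; eexists; exact: hc.
    by apply/esym/cvg_lim.
apply: le_trans (fatou mu mD mh _) _.
  by move=> k x _; rewrite lee_fin sqr_ge0.
have : (fun k => \int[mu]_(x in D) h k x)%E @ \oo --> (l - s n)%:E.
  have -> : (fun k => \int[mu]_(x in D) h k x)%E = EFin \o (fun k => `|s (N k) - s n|).
    apply/funext => k /=; rewrite -ss -ip_integral//; exact: sqintB.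
  have -> : l - s n = `|l - s n| by rewrite ger0_norm// subr_ge0.
  apply: cvg_EFin; first exact: nearW.
  apply: cvg_norm; apply: cvgB; last exact: cvg_cst.
  apply/cvgrPdist_le => e e0.
  have c4 : (fun k => (4 ^- k : R)) @ \oo --> (0 : R).
    under eq_fun do rewrite -exprVn; apply: cvg_expr.
    by rewrite ger0_norm; lra.
  move/cvgrPdist_le : c4 => /(_ _ e0); apply: filterS => k.
  rewrite sub0r normrN => h1; rewrite ger0_norm ?subr_ge0//.
  by apply: le_trans (NP k) (le_trans (ler_norm _) h1).
move=> cv; rewrite is_cvg_limn_einfE; last by apply/cvg_ex; eexists; exact: cv.
by rewrite (cvg_lim _ cv).
Qed.

Theorem riesz_fischer : exists f,
  [/\ sqint mu D f, forall n, ip mu D f (phi n) = c n & ip mu D f f = l].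
Proof.
have sqfS n : sqint mu D (fun x => f x - S n x).
  split; first by apply: measurable_funB => //; case: (sqS n).
  apply/integrableP; split.
    apply/measurable_EFinP/measurable_funX/measurable_funB => //.
    by case: (sqS n).
  under eq_integral => x _ do rewrite gee0_abs ?lee_fin ?sqr_ge0//.
  by apply: le_lt_trans (fatou_f n) _; rewrite ltry.
have sqf : sqint mu D f.
  have := sqintD mD (sqfS 0%N) (sqS 0%N); congr sqint.
  by apply/funext => x; rewrite subrK.
have le_fS n : ip mu D (fun x => f x - S n x) (fun x => f x - S n x) <= l - s n.
  by rewrite -lee_fin -ip_integral.
have to0 : (fun n => l - s n) @ \oo --> (0 : R).
  by rewrite -(subrr l); apply: cvgB => //; exact: cvg_cst.
have fc n : ip mu D f (phi n) = c n.
  have phin := on.1 n.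
  (* For [m > n] the difference is the n-th coefficient of [f - S m], so Bessel's inequality bounds
     its square by the remainder, which tends to 0. *)
  have key m : (n < m)%N -> (ip mu D f (phi n) - c n) ^+ 2 <= l - s m.
    move=> nm; apply: le_trans (le_fS m).
    rewrite (_ : _ - _ = ip mu D (fun x => f x - S m x) (phi n)); last first.
      by rewrite ipB// ip_fsum_phi// nm.
    apply: le_trans (bessel mD on n.+1 (sqfS m)).
    rewrite big_ord_recr/= lerDr; apply: sumr_ge0 => i _; exact: sqr_ge0.
  apply/eqP; rewrite -subr_eq0 -sqrf_eq0 eq_le sqr_ge0 andbT.
  rewrite -(cvg_lim _ to0)//; apply: limr_ge; first by apply/cvg_ex; exists 0.
  by near=> m; apply: key; near: m; exists n.+1.
exists f; split => //.
(* The upper bound is the remainder estimate at [n = 0], where the partial sum is empty; the lower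
   bound is Bessel's inequality in the limit. *)
apply/eqP; rewrite eq_le; apply/andP; split.
  have := le_fS 0%N; rewrite (bessel_eq mD on)//=.
  by rewrite /s !big_ord0 !subr0.
rewrite -(cvg_lim _ sl)//; apply: limr_le; first by apply/cvg_ex; exists l.
apply: nearW => n; apply: le_trans (bessel mD on n sqf).
by under [leRHS]eq_bigr do rewrite fc.
Unshelve. all: by end_near. Qed.

End RieszFischer.

(** * Orthogonality of the Jacobi polynomials *)

Lemma measurable_inv (R : realType) : measurable_fun setT (@GRing.inv R).
Proof.
rewrite -(setUv [set (0 : R)]); apply/measurable_funU => //.
  exact: measurableC.
split; first exact: measurable_fun_set1.
apply: open_continuous_measurable_fun; first exact: closed_openC.
by move=> x; rewrite inE/= => /eqP x0; exact: inv_continuous.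
Qed.

Section Moments.
Variable R : realType.
Notation mu := (@lebesgue_measure R).
Notation D := (`[(-1 : R), 1] : set R).
Implicit Types (v : R -> R) (p q : {poly R}) (s r x : R).

Let mD : measurable D. Proof. exact: measurable_itv. Qed.

Lemma measurable_horner p : measurable_fun D (horner p).
Proof.
by apply: measurable_funTS; apply: continuous_measurable_fun; exact: continuous_horner.
Qed.

Lemma integrable_horner v p : mu.-integrable D (EFin \o v) ->
  mu.-integrable D (EFin \o (fun x => p.[x] * v x)).
Proof.
move=> iv; apply: (@integrableMr _ _ _ mu D mD (horner p) (EFin \o v)) => //.
  exact: measurable_horner.
have /compact_bounded[M [Mr HM]] : compact (horner p @` D).
  apply: continuous_compact; last exact: segment_compact.
  exact/continuous_subspaceT/continuous_horner.
by exists M; split => // y My x Dx; apply: HM => //; exists x.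
Qed.

Definition moment v p : R := \int[mu]_(x in D) (p.[x] * v x).

Lemma momentD v p q : mu.-integrable D (EFin \o v) ->
  moment v (p + q) = moment v p + moment v q.
Proof.
move=> iv; rewrite /moment -RintegralD//; try exact: integrable_horner.
by apply: eq_Rintegral => x _; rewrite hornerE mulrDl.
Qed.

Lemma momentZ v a p : mu.-integrable D (EFin \o v) ->
  moment v (a *: p) = a * moment v p.
Proof.
move=> iv; rewrite /moment -RintegralZl//; last exact: integrable_horner.
by apply: eq_Rintegral => x _; rewrite hornerE mulrA.
Qed.

Lemma momentB v p q : mu.-integrable D (EFin \o v) ->
  moment v (p - q) = moment v p - moment v q.
Proof. by move=> iv; rewrite -scaleN1r momentD// momentZ// mulN1r. Qed.

(* For [s = 0] these are the Chebyshev polynomials of the second kind. *)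
Fixpoint jac s n : {poly R} :=
  if n is n'.+1 then
    if n' is n''.+1 then 2 *: 'X * jac s n' - jac s n'' else 2 *: 'X - s%:P
  else 1.

Lemma jac0 s : jac s 0 = 1. Proof. by []. Qed.

Lemma jac1 s : jac s 1 = 2 *: 'X - s%:P. Proof. by []. Qed.

Lemma jacSS s n : jac s n.+2 = 2 *: 'X * jac s n.+1 - jac s n. Proof. by []. Qed.

Lemma mulX_jac0 s : 2 *: 'X * jac s 0 = jac s 1 + s *: jac s 0.
Proof. by rewrite jac0 jac1 mulr1 -alg_polyC subrK. Qed.

Lemma mulX_jacS s n : 2 *: 'X * jac s n.+1 = jac s n.+2 + jac s n.
Proof. by rewrite jacSS subrK. Qed.

Lemma jacE s n : jac s n.+1 = jac 0 n.+1 - s *: jac 0 n.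
Proof.
have H : jac s n.+1 = jac 0 n.+1 - s *: jac 0 n /\
         jac s n.+2 = jac 0 n.+2 - s *: jac 0 n.+1.
  elim: n => [|n [h1 h2]].
    rewrite !jacSS !jac1 !jac0 -!alg_polyC scale0r -!mul_polyC; split; ring.
  by split=> //; rewrite jacSS h1 h2 !jacSS -!mul_polyC; ring.
by case: H.
Qed.

(** The hypotheses give column 0 of the Gram matrix. Moving the factor 2X from one polynomial to the
    other by the recurrence turns columns [n] and [n.+1] into column [n.+2]. *)
Lemma jac_orthonormal v s : mu.-integrable D (EFin \o v) ->
  moment v 1 = 1 -> (forall n, moment v (jac s n.+1) = 0) ->
  forall m n, moment v (jac s m * jac s n) = (m == n)%:R.
Proof.
move=> iv v1 v0 m n.
have G0 k : moment v (jac s k * jac s 0) = (k == 0)%:R.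
  by rewrite jac0 mulr1; case: k => [|k]; rewrite ?v1 ?v0.
suff H : (forall m, moment v (jac s m * jac s n) = (m == n)%:R) /\
         (forall m, moment v (jac s m * jac s n.+1) = (m == n.+1)%:R) by case: H.
elim: n {m} => [|n [h1 h2]]; split => // m.
  rewrite jac1 mulrC mulrBl mul_polyC momentB// momentZ//.
  case: m => [|m]; first by rewrite mulX_jac0 momentD// momentZ// jac0 v0 v1/=; ring.
  rewrite mulX_jacS momentD// !v0 add0r mulr0 subr0.
  by case: m => [|m]; rewrite ?v0 ?jac0 ?v1.
rewrite jacSS mulrBr momentB// h1 mulrCA mulrA.
case: m => [|m].
  by rewrite mulX_jac0 mulrDl -scalerAl momentD// momentZ// !h2/=; ring.
by rewrite mulX_jacS mulrDl momentD// !h2 !eqSS; ring.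
Qed.

(** The recurrence lowers the exponent in [(2 *: 'X) ^+ k * jac s n] at the price of changing [n],
    so induction on [k] for all [n] at once annihilates every monomial. *)
Lemma jac_total v s : mu.-integrable D (EFin \o v) ->
  (forall n, moment v (jac s n) = 0) -> forall p, moment v p = 0.
Proof.
move=> iv v0 p.
have Xk k n : moment v ((2 *: 'X) ^+ k * jac s n) = 0.
  elim: k n => [n|k ih n]; first by rewrite expr0 mul1r.
  rewrite exprSr -mulrA; case: n => [|n].
    by rewrite mulX_jac0 mulrDr -scalerAr momentD// momentZ// !ih mulr0 addr0.
  by rewrite mulX_jacS mulrDr momentD// !ih addr0.
rewrite -(coefK p) poly_def; elim/big_ind: _.
- by rewrite -[0](scale0r (0 : {poly R})) momentZ// mul0r.
- by move=> f g f0 g0; rewrite momentD// f0 g0 addr0.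
- move=> i _; rewrite momentZ//.
  have := Xk i 0%N; rewrite jac0 mulr1 exprZn momentZ// => /eqP.
  by rewrite mulf_eq0 expf_eq0 pnatr_eq0 andbF/= => /eqP->; rewrite mulr0.
Qed.

(** * Moments of the semicircle law *)

Definition semicircle x : R := 2 / pi * Num.sqrt (1 - x ^+ 2).

Lemma continuous_semicircle : continuous semicircle.
Proof.
move=> x; apply: cvgM; first exact: cvg_cst.
apply: (@continuous_comp _ _ _ (fun x => 1 - x ^+ 2) Num.sqrt); last exact: sqrt_continuous.
by apply: cvgB; [exact: cvg_cst|exact: exprn_continuous].
Qed.

Lemma integrable_semicircle : mu.-integrable D (EFin \o semicircle).
Proof.
apply: continuous_compact_integrable; first exact: segment_compact.
exact/continuous_subspaceT/continuous_semicircle.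
Qed.

(** This is U_n(cos t) = sin((n+1)t) / sin t, multiplied out so that the zeros of the sine need no
    exception. *)
Lemma jac_cos n (t : R) : (jac 0 n).[cos t] * sin t = sin (n.+1%:R * t).
Proof.
have H : (jac 0 n).[cos t] * sin t = sin (n.+1%:R * t) /\
   (jac 0 n.+1).[cos t] * sin t = sin (n.+2%:R * t).
  elim: n => [|n [h1 h2]].
    split; first by rewrite jac0 !hornerE ?mul1r.
    by rewrite (mulr_natl t 2) mulr2n sinD jac1 !hornerE; ring.
  split => //; rewrite jacSS !hornerE.
  transitivity (2 * cos t * ((jac 0 n.+1).[cos t] * sin t)
    - (jac 0 n).[cos t] * sin t); first by ring.
  rewrite h1 h2.
  have e3 : n.+3%:R * t = n.+2%:R * t + t by rewrite -[n.+3%:R]natr1; ring.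
  have e1 : n.+1%:R * t = n.+2%:R * t - t by rewrite -[n.+2%:R]natr1; ring.
  rewrite e3 e1.
  by rewrite !sinD sinN cosN; ring.
by case: H.
Qed.

Lemma sin_natpi n : sin (n%:R * pi : R) = 0.
Proof.
elim: n => [|n ih]; first by rewrite mul0r sin0.
by rewrite -natr1 mulrDl mul1r sinDpi ih oppr0.
Qed.

Lemma is_derive_sin_scale (k t : R) :
  is_derive t 1 (fun t => sin (k * t)) (k * cos (k * t)).
Proof.
have dk : is_derive t 1 (fun t => k * t) k.
  by have := is_deriveZ k (is_derive_id t 1); rewrite /GRing.scale/= mulr1.
have := is_derive1_comp (is_derive_sin (k * t)) dk.
by rewrite mulrC.
Qed.

(** At [n = 0] the term cos(nt) is constant, so its primitive is [t] and not a sine. *)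
Let cos_antiderivative n (t : R) : R :=
  pi^-1 * ((if n is m.+1 then n%:R^-1 * sin (n%:R * t) else t)
           - n.+2%:R^-1 * sin (n.+2%:R * t)).

Let is_derive_antiderivative n (t : R) : is_derive t 1 (cos_antiderivative n)
  (pi^-1 * (cos (n%:R * t) - cos (n.+2%:R * t))).
Proof.
have d2 : is_derive t 1 (fun t => n.+2%:R^-1 * sin (n.+2%:R * t)) (cos (n.+2%:R * t)).
  have := is_deriveZ (n.+2%:R^-1) (is_derive_sin_scale n.+2%:R t).
  by rewrite /GRing.scale/= mulKf// pnatr_eq0.
have d1 : is_derive t 1 (fun t => if n is m.+1 then n%:R^-1 * sin (n%:R * t) else t)
    (cos (n%:R * t)).
  case: n {d2} => [|n]; first by rewrite mul0r cos0; exact: is_derive_id.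
  have := is_deriveZ (n.+1%:R^-1) (is_derive_sin_scale n.+1%:R t).
  by rewrite /GRing.scale/= mulKf// pnatr_eq0.
exact: (is_deriveZ (pi^-1) (is_deriveB d1 d2)).
Qed.

Lemma moment_semicircle n : moment semicircle (jac 0 n) = (n == 0)%:R.
Proof.
pose G x := (jac 0 n).[x] * semicircle x.
have cG : continuous G.
  by move=> x; apply: cvgM; [exact: continuous_horner|exact: continuous_semicircle].
have pi0 := @pi_gt0 R.
have dcos : (cos^`() : R -> R) = (fun t => - sin t).
  by apply/funext => t; rewrite derive1E (@derive_val _ _ _ _ _ _ _ (is_derive_cos t)).
have csin : continuous (fun t : R => - sin t).
  by move=> t; apply: cvgN; exact: continuous_sin.
have := @integration_by_substitution_decreasing R cos G 0 pi (ltW pi0).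
rewrite cospi cos0 dcos => /(_ _ _ _ _ _ _) sub.
rewrite /moment /Rintegral {}sub; last first.
- exact: continuous_subspaceT.
- split=> [x _||]; first exact: (@ex_derive _ _ _ _ _ _ _ (is_derive_cos x)).
    by apply: cvg_at_right_filter; exact: continuous_cos.
  by apply: cvg_at_left_filter; exact: continuous_cos.
- by apply/cvg_ex; exists (- sin pi); apply: cvg_at_left_filter; exact: csin.
- by apply/cvg_ex; exists (- sin 0); apply: cvg_at_right_filter; exact: csin.
- by move=> x _; exact: csin.
- by move=> x y x0 y0; rewrite ltr_cos.
(* After x = cos t, one factor sin t comes from the square root and one from the derivative of the
   cosine; with [jac_cos] the integrand becomes (2/pi) sin((n+1)t) sin t, which is [g]. *)
pose g (t : R) := pi^-1 * (cos (n%:R * t) - cos (n.+2%:R * t)).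
transitivity (fine (\int[mu]_(t in `[(0 : R)%R, pi]) (g t)%:E)%E).
  congr fine; apply: eq_integral => t; rewrite inE/= in_itv/= => /andP[t0 t1]; congr EFin.
  change (G (cos t) * - - sin t = g t).
  rewrite /G /semicircle /g opprK -sin2cos2 sqrtr_sqr ger0_norm ?sin_ge0_pi ?t0//.
  transitivity (2 / pi * ((jac 0 n).[cos t] * sin t) * sin t); first by ring.
  have e2 : n.+2%:R * t = n.+1%:R * t + t by rewrite -[n.+2%:R]natr1; ring.
  have e0 : n%:R * t = n.+1%:R * t - t by rewrite -[n.+1%:R]natr1; ring.
  by rewrite jac_cos e2 e0 !cosD sinN cosN; ring.
rewrite (@continuous_FTC2 _ _ (cos_antiderivative n))//; last first.
- by move=> t _; rewrite derive1E (@derive_val _ _ _ _ _ _ _ (is_derive_antiderivative n t)).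
- have d t : derivable (cos_antiderivative n) t 1.
    exact: (@ex_derive _ _ _ _ _ _ _ (is_derive_antiderivative n t)).
  have c t : {for t, continuous (cos_antiderivative n)}.
    by apply: differentiable_continuous; apply/derivable1_diffP.
  split=> [//||]; [exact: cvg_at_right_filter (c 0)|exact: cvg_at_left_filter (c pi)].
- apply: continuous_subspaceT => t; apply: cvgM; first exact: cvg_cst.
  have cc (k : R) : continuous (fun t => cos (k * t)).
    move=> u; apply: (@continuous_comp _ _ _ (fun t => k * t) cos).
      exact: mulrl_continuous.
    exact: continuous_cos.
  by apply: cvgB; exact: cc.
(* All sines vanish at both endpoints; only the linear term for [n = 0] survives. *)
rewrite /= /cos_antiderivative !sin_natpi !mulr0 sin0.
case: n {G cG g} => [|n]; last by rewrite !(mulr0, sin0, subr0).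
by rewrite !(mulr0, subr0) mulVf// (gt_eqF pi0).
Qed.

Lemma moment_semicircle_sqr n : moment semicircle (jac 0 n * jac 0 n) = 1.
Proof.
rewrite (jac_orthonormal integrable_semicircle) ?eqxx//.
  by have := moment_semicircle 0.
by move=> m; rewrite moment_semicircle.
Qed.

(** * The weight and its limit as the parameter tends to 1 *)

Definition den r x : R := 1 - 2 * r * x + r ^+ 2.

(** At r = N^(-1/2) this is [rho]. The parameter is free so that r = 1 can be reached as a limit
    from below. *)
Definition wgt r x : R := semicircle x / den r x.

Lemma semicircle_ge0 x : 0 <= semicircle x.
Proof. by rewrite mulr_ge0 ?sqrtr_ge0// divr_ge0// pi_ge0. Qed.

Lemma semicircle1 : semicircle 1 = 0.
Proof. by rewrite /semicircle expr1n subrr sqrtr0 mulr0. Qed.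

(** The difference of the two sides is 2r(1 - x). *)
Lemma den_ge r x : 0 < r <= 1 -> D x -> (1 - r) ^+ 2 <= den r x.
Proof. by rewrite /= in_itv/= /den => /andP[? ?] /andP[? ?]; nra. Qed.

Lemma den_gt0 r x : 0 < r < 1 -> D x -> 0 < den r x.
Proof.
move=> /andP[r0 r1] Dx; apply: lt_le_trans (den_ge _ Dx); last by lra.
by rewrite exprn_gt0// subr_gt0.
Qed.

Lemma wgt_ge0 r x : 0 < r <= 1 -> D x -> 0 <= wgt r x.
Proof.
move=> r01 Dx; rewrite divr_ge0 ?semicircle_ge0//.
by apply: le_trans (den_ge r01 Dx); exact: sqr_ge0.
Qed.

Lemma continuous_den r : continuous (den r).
Proof.
move=> x; apply: cvgD; last exact: cvg_cst.
by apply: cvgB; [exact: cvg_cst|exact: mulrl_continuous].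
Qed.

Lemma measurable_wgt r : measurable_fun D (wgt r).
Proof.
apply: measurable_funM.
  apply: measurable_funTS; apply: continuous_measurable_fun.
  exact: continuous_semicircle.
apply: measurableT_comp; first exact: measurable_inv.
by apply: measurable_funTS; apply: continuous_measurable_fun; exact: continuous_den.
Qed.

(** A zero of the denominator forces r = x = 1, where the semicircle density vanishes too, so the
    convention for division by 0 does no harm. *)
Lemma wgtM_den r x : 0 < r <= 1 -> D x -> den r x * wgt r x = semicircle x.
Proof.
move=> /andP[r0 r1] Dx; rewrite /wgt; have [d0|d0] := eqVneq (den r x) 0.
  rewrite d0 mul0r; move: Dx d0; rewrite /= in_itv/= /den => /andP[x0 x1] d0.
  suff -> : x = 1 by rewrite semicircle1.
  by nra.
by rewrite mulrC divfK.
Qed.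

Lemma integrable_wgt_lt1 r : 0 < r < 1 -> mu.-integrable D (EFin \o wgt r).
Proof.
move=> r01; apply: (@le_integrable _ _ _ mu D mD _
  (EFin \o (fun x => (1 - r) ^- 2 * semicircle x))).
- by apply/measurable_EFinP; exact: measurable_wgt.
- move=> x Dx; rewrite lee_fin ger0_norm; last by apply: wgt_ge0 => //; lra.
  have q0 : 0 < (1 - r) ^+ 2 by rewrite exprn_gt0//; lra.
  rewrite ger0_norm; last first.
    by apply: mulr_ge0; [rewrite invr_ge0 ltW|exact: semicircle_ge0].
  rewrite /wgt [leRHS]mulrC ler_wpM2l ?semicircle_ge0// lef_pV2 ?posrE ?den_gt0//.
  by apply: den_ge => //; lra.
- exact: (integrableZl (mu := mu) mD ((1 - r) ^- 2) integrable_semicircle).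
Qed.

Definition denp r : {poly R} := (1 + r ^+ 2)%:P - (2 * r) *: 'X.

Lemma moment_denp r p : 0 < r <= 1 ->
  moment (wgt r) (denp r * p) = moment semicircle p.
Proof.
move=> r01; apply: eq_Rintegral => x; rewrite inE => Dx.
rewrite hornerM -(wgtM_den r01 Dx) mulrAC mulrC; congr (_ * (_ * _)).
by rewrite /denp /den !hornerE; ring.
Qed.

(** The polynomial [jac r n - r *: jac r n.+1] equals [denp r * jac 0 n], so the denominator of the
    weight cancels and a semicircle moment remains. *)
Lemma moment_wgt_rec r n : 0 < r <= 1 -> mu.-integrable D (EFin \o wgt r) ->
  moment (wgt r) (jac r n) - r * moment (wgt r) (jac r n.+1) = (n == 0)%:R.
Proof.
move=> r01 iw; rewrite -momentZ// -momentB//.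
rewrite -moment_semicircle -(moment_denp _ r01); congr moment.
case: n => [|n]; first by rewrite jac1 !jac0 /denp -!mul_polyC !rmorphE/=; ring.
rewrite !(jacE r) jacSS /denp -!mul_polyC !rmorphE/=; ring.
Qed.

(** The recurrence gives b_1 = r^n b_(n+1) for the moments b_n of [jac r n]. These are bounded in
    [n], so letting [n] grow gives b_1 = 0. *)
Let moment_lt1 r : 0 < r < 1 -> moment (wgt r) (jac r 1) = 0.
Proof.
move=> r01; have r01' : 0 < r <= 1 by lra.
have iw := integrable_wgt_lt1 r01.
have q0 : 0 < (1 - r) ^+ 2 by rewrite exprn_gt0//; lra.
have itq n : moment (wgt r) (jac r 1) = r ^+ n * moment (wgt r) (jac r n.+1).
  elim: n => [|n ->]; first by rewrite expr0 mul1r.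
  have /eqP := moment_wgt_rec n.+1 r01' iw; rewrite subr_eq0 => /eqP ->.
  by rewrite exprSr mulrA.
(* Here |U_n| <= 1 + U_n^2, whose semicircle integral is 2, and [wgt r] is at most [(1 - r) ^- 2]
   times the semicircle density. *)
have aU n : `|moment (wgt r) (jac 0 n)| <= 2 * (1 - r) ^- 2.
  have iU := integrable_horner (jac 0 n) iw.
  rewrite /moment; apply: le_trans (le_normr_Rintegral (mu := mu) mD iU) _.
  rewrite (_ : 2 * _ = \int[mu]_(x in D)
      (((1 - r) ^- 2 *: (1 + jac 0 n * jac 0 n)).[x] * semicircle x)); last first.
    rewrite -/(moment _ _) momentZ ?momentD ?moment_semicircle_sqr;
      try exact: integrable_semicircle.
    by have := moment_semicircle 0; rewrite jac0 => ->; rewrite mulrC.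
  apply: le_Rintegral => //.
  - exact: integrable_norm.
  - exact: integrable_horner integrable_semicircle.
  - move=> x Dx; rewrite normrM (ger0_norm (wgt_ge0 r01' Dx)).
    set J := (jac 0 n).[x].
    have -> : ((1 - r) ^- 2 *: (1 + jac 0 n * jac 0 n)).[x] =
        (1 - r) ^- 2 * (1 + `|J| ^+ 2).
      by rewrite real_normK ?num_real// !hornerE expr2.
    have d0 := den_gt0 r01 Dx; have J0 := normr_ge0 J.
    rewrite /wgt mulrCA [leRHS]mulrC ler_wpM2l ?semicircle_ge0// [leLHS]mulrC.
    rewrite ler_pM ?invr_ge0 ?(ltW d0)//.
      by rewrite lef_pV2 ?posrE//; exact: den_ge.
    by nra.
(* Since [jac r n.+1] is U_(n+1) - r U_n with r < 1, twice the bound [aU] suffices. *)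
have cv : (fun n => r ^+ n * (4 * (1 - r) ^- 2)) @ \oo --> (0 : R).
  rewrite -(mul0r (4 * (1 - r) ^- 2)); apply: cvgM; last exact: cvg_cst.
  by apply: cvg_expr; rewrite ger0_norm; lra.
apply/eqP; rewrite -normr_eq0 eq_le normr_ge0 andbT -(cvg_lim _ cv)//.
apply: limr_ge; first by apply/cvg_ex; exists 0.
apply: nearW => n; rewrite (itq n) normrM ger0_norm ?exprn_ge0 ?ler_wpM2l ?exprn_ge0//; try lra.
rewrite jacE momentB// momentZ//.
apply: le_trans (ler_normB _ _) _; rewrite normrM ger0_norm; last by lra.
have := aU n.+1; have := aU n; have := normr_ge0 (moment (wgt r) (jac 0 n)).
by nra.
Qed.

(** For r >= 1/2, 2 den r x >= 4r(1 - x) >= 2(1 - x) = den 1 x. At x = 1 both weights vanish. *)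
Let wgt_le2 r x : 1 / 2 <= r < 1 -> D x -> wgt r x <= 2 * wgt 1 x.
Proof.
move=> /andP[r0 r1] Dx; have [->|x1] := eqVneq x 1.
  by rewrite /wgt semicircle1 !mul0r mulr0.
have r01 : 0 < r < 1 by lra.
have d0 := den_gt0 r01 Dx.
have d1 : 0 < den 1 x.
  by move: Dx x1; rewrite /den/= in_itv/= => /andP[_]; rewrite lt_neqAle => h -; nra.
rewrite /wgt mulrCA ler_wpM2l ?semicircle_ge0//.
rewrite -[2](invrK 2) -invfM lef_pV2 ?posrE ?mulr_gt0 ?invr_gt0//.
by move: Dx; rewrite /den/= in_itv/= => /andP[? ?]; nra.
Qed.

(** The shift by 2 keeps [rk k] at or above 1/2, as [wgt_le2] requires. *)
Let rk k : R := 1 - k.+2%:R^-1.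

Let rk_itv k : 1 / 2 <= rk k < 1.
Proof.
have H (u : R) : 0 < u -> u <= 2^-1 -> 1 / 2 <= 1 - u < 1 by lra.
by apply: H; [rewrite invr_gt0|rewrite lef_pV2 ?posrE// ler_nat].
Qed.

Let rk_cvg : rk @ \oo --> (1 : R).
Proof.
rewrite -[X in _ --> X]subr0; apply: cvgB; first exact: cvg_cst.
have := @cvg_harmonic R; rewrite -(cvg_shiftS (@harmonic R)).
exact.
Qed.

Let wgt_cvg x : D x -> (fun k => (wgt (rk k) x)%:E) @ \oo --> (wgt 1 x)%:E.
Proof.
move=> Dx; apply: cvg_EFin; first exact: nearW.
rewrite (_ : fine \o _ = fun k => semicircle x / den (rk k) x)//.
have [->|x1] := eqVneq x 1.
  rewrite /wgt semicircle1 !mul0r; under eq_fun do rewrite mul0r; exact: cvg_cst.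
apply: cvgM; first exact: cvg_cst.
apply: cvgV.
  apply: lt0r_neq0; move: Dx x1; rewrite /den/= in_itv/= => /andP[_].
  by rewrite le_eqVlt => /orP[/eqP->|]; [rewrite eqxx|nra].
rewrite /den; apply: cvgD.
  apply: cvgB; first exact: cvg_cst.
  apply: cvgM; last exact: cvg_cst.
  by apply: cvgM => //; exact: cvg_cst.
rewrite expr2; under eq_fun do rewrite expr2.
exact: cvgM.
Qed.

Let moment_rk k : (\int[mu]_(x in D) (wgt (rk k) x)%:E = 1)%E.
Proof.
have /andP[r0 r1] := rk_itv k; have r01 : 0 < rk k < 1 by lra.
have iw := integrable_wgt_lt1 r01.
have := @moment_wgt_rec (rk k) 0 _ iw; rewrite moment_lt1// mulr0 subr0.
move=> /(_ ltac:(lra)) /= h; rewrite -[LHS]fineK; last exact: integrable_fin_num.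
congr EFin; rewrite -[RHS]h; apply: eq_Rintegral => x _.
by rewrite (hornerC 1) mul1r.
Qed.

(** Fatou's lemma, since each [wgt (rk k)] has mass 1. This makes [2 * wgt 1] available as a
    dominating function in [moment_wgt]. *)
Let integrable_wgt1 : mu.-integrable D (EFin \o wgt 1).
Proof.
have l1 : 0 < (1 : R) <= 1 by lra.
apply/integrableP; split; first by apply/measurable_EFinP; exact: measurable_wgt.
apply: (@le_lt_trans _ _ 1%E); last exact: ltry.
rewrite [leLHS](_ : _ =
  (\int[mu]_(x in D) limn_einf (fun k => (wgt (rk k) x)%:E))%E); last first.
  apply: eq_integral => x; rewrite inE => Dx /=; rewrite ger0_norm ?wgt_ge0//.
  by rewrite is_cvg_limn_einfE; [apply/esym/cvg_lim => //|apply/cvg_ex; eexists]; exact: wgt_cvg.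
apply: le_trans (fatou mu mD _ _) _.
- by move=> k; apply/measurable_EFinP; exact: measurable_wgt.
- move=> k x Dx; rewrite lee_fin wgt_ge0//; have := rk_itv k; lra.
rewrite [X in limn_einf X](_ : _ = (fun=> 1%E)); last by apply/funext => k; exact: moment_rk.
by rewrite is_cvg_limn_einfE; [rewrite lim_cst|exact: is_cvg_cst].
Qed.

Lemma integrable_wgt r : 0 < r <= 1 -> mu.-integrable D (EFin \o wgt r).
Proof.
move=> /andP[r0]; rewrite le_eqVlt => /orP[/eqP->//|r1].
by apply: integrable_wgt_lt1; lra.
Qed.

Lemma moment_wgt r n : 0 < r <= 1 -> moment (wgt r) (jac r n) = (n == 0)%:R.
Proof.
move=> r01; have iw := integrable_wgt r01.
(* From b_1 = 0 the recurrence gives b_0 = 1 and, as r is nonzero, carries the zero up to every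
   later index. *)
suff m1 : moment (wgt r) (jac r 1) = 0.
  case: n => [|n]; first by have := moment_wgt_rec 0 r01 iw; rewrite m1 mulr0 subr0.
  elim: n => [//|n ih]; have := moment_wgt_rec n.+1 r01 iw.
  rewrite ih sub0r => /eqP; rewrite oppr_eq0 mulf_eq0 => /orP[/eqP r0|/eqP//].
  by move: r01; rewrite r0 ltxx.
have [r1|r1] := ltP r 1; first by apply: moment_lt1; lra.
have {r1 r01} r1 : r = 1 by lra.
rewrite {}r1 in iw *; have l1 : 0 < (1 : R) <= 1 by lra.
have := moment_wgt_rec 0 l1 iw; rewrite mul1r eqxx.
(* The recurrence at r = 1 reads b_0 - b_1 = 1, so it is enough that the mass b_0 is 1; this follows
   by dominated convergence. *)
suff -> : moment (wgt 1) (jac 1 0) = 1.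
  by move/eqP; rewrite subr_eq addrC -subr_eq subrr => /eqP.
have mw k : measurable_fun D (fun x => (wgt (rk k) x)%:E).
  by apply/measurable_EFinP; exact: measurable_wgt.
have mw1 : measurable_fun D (EFin \o wgt 1).
  by apply/measurable_EFinP; exact: measurable_wgt.
have cw : {ae mu, forall x, D x -> (fun k => (wgt (rk k) x)%:E) @ \oo -->
    (EFin \o wgt 1) x} by apply: aeW => x; exact: wgt_cvg.
have dw : {ae mu, forall x k, D x -> (`|(wgt (rk k) x)%:E| <= (2 * wgt 1 x)%:E)%E}.
  apply: aeW => x k Dx; have rki := rk_itv k; rewrite lee_fin ger0_norm ?wgt_le2//.
  by apply: wgt_ge0 => //; lra.
have i2 : mu.-integrable D (fun x => (2 * wgt 1 x)%:E) by exact: (integrableZl (mu := mu) mD 2 iw).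
have [_ _] := dominated_convergence (mu := mu) mD mw mw1 cw i2 dw.
rewrite (_ : [sequence _]_n = (fun=> 1%E)); last by apply/funext => k; exact: moment_rk.
move=> /(cvg_lim (@ereal_hausdorff R)); rewrite lim_cst// => /(congr1 fine) /= e.
rewrite [RHS]e; apply: eq_Rintegral => x _.
by rewrite (hornerC 1) mul1r.
Qed.

End Moments.

(** * Totality of the polynomials *)

Section PolynomialTotality.
Variable R : realType.
Notation mu := (@lebesgue_measure R).
Notation D := (`[(-1 : R), 1] : set R).

Let mD : measurable D. Proof. exact: measurable_itv. Qed.

Lemma bernoulli_le (u : R) m : 0 <= u <= 1 -> 1 - m%:R * u <= (1 - u) ^+ m.
Proof.
move=> /andP[u0 u1]; elim: m => [|m ih]; first by rewrite mul0r subr0 expr0.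
rewrite exprS; apply: (@le_trans _ _ ((1 - u) * (1 - m%:R * u))).
  by rewrite -natr1; have := ler0n R m; nra.
by apply: ler_wpM2l ih; lra.
Qed.

Lemma bernoulli_ge (u : R) m : 0 <= u -> 1 + m%:R * u <= (1 + u) ^+ m.
Proof.
move=> u0; elim: m => [|m ih]; first by rewrite mul0r addr0 expr0.
rewrite exprS; apply: (@le_trans _ _ ((1 + u) * (1 + m%:R * u))).
  by rewrite -natr1; have := ler0n R m; nra.
by apply: ler_wpM2l ih; lra.
Qed.

(** As 2^n y^n = (2y)^n, the exponent 2^n puts the jump of the limit at y = 1/2. *)
Definition step_fun (y : R) n : R := (1 - y ^+ n) ^+ (2 ^ n).

Lemma step_fun_bound y n : 0 <= y <= 1 -> 0 <= step_fun y n <= 1.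
Proof.
move=> /andP[y0 y1]; have y2 : 0 <= y ^+ n <= 1 by rewrite exprn_ge0//= exprn_ile1.
by rewrite exprn_ge0 ?exprn_ile1//; lra.
Qed.

Lemma step_fun_cvg1 y : 0 <= y < 1 / 2 -> step_fun y @ \oo --> (1 : R).
Proof.
move=> /andP[y0 y1].
apply: (@squeeze_cvgr _ _ _ _ (fun n => 1 - (2 * y) ^+ n) (fun=> 1)).
- apply: nearW => n; have yy : 0 <= y <= 1 by lra.
  case/andP: (step_fun_bound n yy) => _ ->; rewrite andbT.
  apply: le_trans (bernoulli_le (2 ^ n) _); first by rewrite natrX exprMn.
  by rewrite exprn_ge0//= exprn_ile1//; lra.
- rewrite -[X in _ --> X]subr0; apply: cvgB; first exact: cvg_cst.
  by apply: cvg_expr; rewrite ger0_norm; lra.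
- exact: cvg_cst.
Qed.

(** Since (1 - y^n)(1 + y^n) <= 1, the reciprocal of (1 + y^n)^(2^n) is an upper bound, and
    Bernoulli's inequality makes it at most (2y)^-n. *)
Lemma step_fun_cvg0 y : 1 / 2 < y <= 1 -> step_fun y @ \oo --> (0 : R).
Proof.
move=> /andP[y0 y1].
apply: (@squeeze_cvgr _ _ _ _ (fun=> 0) (fun n => (2 * y)^-1 ^+ n)).
- apply: nearW => n; have yy : 0 <= y <= 1 by lra.
  case/andP: (step_fun_bound n yy) => -> _ /=.
  have y2 : 0 <= y ^+ n <= 1 by rewrite exprn_ge0 ?exprn_ile1//; lra.
  have p0 : 0 < (2 * y) ^+ n by apply: exprn_gt0; lra.
  rewrite exprVn -[leRHS]mul1r ler_pdivlMr//.
  have h : (2 * y) ^+ n <= (1 + y ^+ n) ^+ (2 ^ n).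
    apply: le_trans (bernoulli_ge (2 ^ n) _); last by case/andP: y2.
    by rewrite natrX exprMn; lra.
  apply: le_trans (ler_wpM2l _ h) _; first by apply: exprn_ge0; lra.
  rewrite -exprMn; apply: exprn_ile1; nra.
- exact: cvg_cst.
- by apply: cvg_expr; rewrite ger0_norm ?invr_ge0 ?invf_lt1; lra.
Qed.

Variable h : R -> R.
Hypothesis ih : mu.-integrable D (EFin \o h).
Hypothesis h0 : forall p : {poly R}, \int[mu]_(x in D) (p.[x] * h x) = 0.

Let below a : \int[mu]_(x in D) (h \_ `]-oo, a]) x = 0.
Proof.
(* On [D], |x - a| <= 1 + |a|; this slope makes [y] map [D] into [0, 1] and [a] to the jump 1/2. *)
pose b : R := (2 * (1 + `|a|))^-1.
have A0 := normr_ge0 a.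
have b0 : 0 < b by rewrite invr_gt0; lra.
pose y x : R := b * (x - a) + 1 / 2.
have yb x : D x -> 0 <= y x <= 1.
  rewrite /= in_itv/= => /andP[x1 x2]; rewrite /y.
  have : `|b * (x - a)| <= 1 / 2.
    rewrite normrM (gtr0_norm b0) /b mulrC ler_pdivrMr; last lra.
    apply: le_trans (ler_normB _ _) _.
    have : `|x| <= 1 by rewrite ler_norml; lra.
    lra.
  by rewrite ler_norml; lra.
pose q n : {poly R} := (1 - (b *: ('X - a%:P) + (1/2)%:P) ^+ n) ^+ (2 ^ n).
have qE n x : (q n).[x] = step_fun (y x) n.
  by rewrite /q /step_fun /y !(horner_exp, hornerE).
have mh : measurable_fun D h by apply/measurable_EFinP; exact: measurable_int ih.
have mq n : measurable_fun D (horner (q n)) := measurable_horner (q n).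
have qb n x : D x -> 0 <= (q n).[x] <= 1.
  by move=> Dx; rewrite qE; exact: step_fun_bound (yb x Dx).
have mqh n : measurable_fun D (fun x => ((q n).[x] * h x)%:E).
  by apply/measurable_EFinP; exact: measurable_funM.
have mha : measurable_fun D (EFin \o (h \_ `]-oo, a])).
  apply/measurable_EFinP/measurable_restrict => //.
  exact: measurable_funS mh.
have qa : {ae mu, forall x, D x -> (fun n => ((q n).[x] * h x)%:E) @ \oo -->
    (EFin \o (h \_ `]-oo, a])) x}.
  (* At [x = a] the values of [q n] tend neither to 0 nor to 1, so this point is left out as a null
     set. *)
  exists [set a]; split => //; first exact: lebesgue_measure_set1.
  apply: subsetCl => x /= /eqP xa Dx.
  apply: cvg_EFin; first exact: nearW.
  rewrite (_ : fine \o _ = fun n => step_fun (y x) n * h x); last first.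
    by apply/funext => n /=; rewrite qE.
  rewrite patchE; move: (yb x Dx) => ybx; case: ifPn => [|].
    rewrite inE/= in_itv/= => xa'.
    rewrite -[X in _ --> X]mul1r; apply: cvgM; last exact: cvg_cst.
    apply: step_fun_cvg1; move: ybx => /andP[-> _] /=.
    by rewrite /y gtrDr pmulr_rlt0// subr_lt0 lt_neqAle xa.
  rewrite notin_setE/= in_itv/= => /negP; rewrite -ltNge => xa'.
  rewrite (_ : point = 0 * h x); last by rewrite mul0r.
  apply: cvgM; last exact: cvg_cst.
  apply: step_fun_cvg0; move: ybx => /andP[_ ->]; rewrite andbT.
  by rewrite /y ltrDr pmulr_rgt0// subr_gt0.
have qd : {ae mu, forall x n, D x -> (`|((q n).[x] * h x)%:E| <= `|h x|%:E)%E}.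
  apply: aeW => x n Dx; rewrite lee_fin normrM ler_piMl//.
  by case/andP: (qb n x Dx) => ? ?; rewrite ger0_norm.
have [_ _] := dominated_convergence (mu := mu) mD mqh mha qa (integrable_abse ih) qd.
have -> : [sequence (\int[mu]_(x in D) ((q n).[x] * h x)%:E)%E]_n = (fun=> 0%E).
  apply/funext => n; rewrite /= -[LHS]fineK; first by rewrite -/(Rintegral _ _ _) h0.
  apply: integrable_fin_num => //.
  apply: (@le_integrable _ _ _ mu D mD _ (EFin \o h)) => //.
    exact: mqh.
  move=> x Dx; rewrite lee_fin normrM ler_piMl//.
  by case/andP: (qb n x Dx) => ? ?; rewrite ger0_norm.
by move=> /(cvg_lim (@ereal_hausdorff R)); rewrite lim_cst// /Rintegral => <-.
Qed.

(** By [below] the primitive of [h], extended by zero, vanishes identically; Lebesgue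
    differentiation recovers [h] from it almost everywhere. *)
Lemma poly_total : ae_eq mu D (EFin \o h) (cst 0%E).
Proof.
pose g := h \_ D.
have ig : mu.-integrable setT (EFin \o g).
  have := (integrable_mkcond (mu := mu) (EFin \o h) mD).1 ih.
  by rewrite restrict_EFin.
have ig' y : mu.-integrable `]-oo, y] (EFin \o g).
  by apply: integrableS ig.
have lg : locally_integrable setT g.
  by apply: integrable_locally.
have := FTC1Ny ig' lg; apply: filterS => [|x [_ Fx] Dx /=].
  exact: (ae_filter_ringOfSetsType mu).
move: Fx; rewrite /g patchE mem_set//= => <-.
rewrite (_ : (fun _ => _) = cst 0) ?derive1_cst//.
apply/funext => z; rewrite -Rintegral_mkcondr setIC Rintegral_mkcondr.
exact: below.
Qed.
End PolynomialTotality.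

(** * Radial vectors on the tree *)

Section Radial.
Variables (R : realType) (N : nat).
Hypothesis hN : (1 <= N)%N.
Implicit Types (c : nat -> C R) (v : vec R N).

Notation sN := (Num.sqrt (N%:R : R)).

Lemma sqrtN_gt0 : 0 < sN. Proof. by rewrite sqrtr_gt0 ltr0n. Qed.

Lemma sqr_sqrtN : sN ^+ 2 = N%:R. Proof. by rewrite sqr_sqrtr. Qed.

Lemma csqM (x y : C R) : csq (x * y) = csq x * csq y.
Proof. by case: x y => [a b] [a' b']; rewrite /csq /=; ring. Qed.

Lemma csq_ge0 (x : C R) : 0 <= csq x.
Proof. by rewrite addr_ge0 ?sqr_ge0. Qed.

Lemma csq_eq0 (x : C R) : csq x = 0 -> x = 0.
Proof.
case: x => a b /eqP; rewrite /csq /= paddr_eq0 ?sqr_ge0// !sqrf_eq0.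
by move=> /andP[/eqP-> /eqP->].
Qed.

Lemma csqB_le (x y : C R) : csq (x - y) <= 2 * (csq x + csq y).
Proof.
case: x y => [a b] [a' b']; rewrite /csq /=.
by have := sqr_ge0 (a + a'); have := sqr_ge0 (b + b'); rewrite !expr2; nra.
Qed.

Definition invsqrtN : C R := real_complex R sN^-1.

Lemma csq_invsqrtN n : csq (invsqrtN ^+ n) = N%:R ^- n.
Proof.
elim: n => [|n ih]; first by rewrite !expr0 invr1 /csq /= expr1n expr0n addr0.
rewrite exprS csqM ih exprS invfM; congr (_ * _).
by rewrite /csq /= expr0n addr0 exprVn sqr_sqrtN.
Qed.

Lemma s0powE p (w : word N) : s0pow R p w = if size w == p then invsqrtN ^+ p else 0.
Proof. by rewrite /s0pow /invsqrtN -rmorphXn/= exprVn. Qed.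

(** The vector with coordinates [c] in the basis of the [s0pow], given pointwise so that every
    sequence [c] is allowed. *)
Definition rad c : vec R N := fun w => c (size w) * invsqrtN ^+ size w.

(** A radial vector is determined by one word of each length; a constant word is used, and the
    factor undoes the normalisation of [rad]. *)
Definition coef v (n : nat) : C R :=
  real_complex R (sN ^+ n) * v (nseq n (Ordinal hN)).

Lemma sqrtNX_invK n : real_complex R (sN ^+ n) * invsqrtN ^+ n = 1.
Proof.
by rewrite /invsqrtN -rmorphXn -rmorphM exprVn divff ?rmorph1// expf_neq0// gt_eqF// sqrtN_gt0.
Qed.

Lemma coef_rad c : coef (rad c) = c.
Proof. by apply/funext => n; rewrite /coef /rad size_nseq mulrCA sqrtNX_invK mulr1. Qed.

Lemma lvl_sq_rad c n : lvl_sq (rad c) n = csq (c n).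
Proof.
rewrite /lvl_sq; under eq_bigr do rewrite /rad size_tuple csqM csq_invsqrtN.
rewrite sumr_const card_tuple card_ord -[LHS]mulr_natr natrX -mulrA mulVf ?mulr1//.
by rewrite expf_neq0// pnatr_eq0 -lt0n.
Qed.

Lemma l2sq_rad c : l2sq (rad c) = (\sum_(0 <= n <oo) (csq (c n))%:E)%E.
Proof. by congr (limn _); apply/funext => n; apply: eq_bigr => i _; rewrite lvl_sq_rad. Qed.

Lemma span_eltE n c (w : word N) :
  span_elt n c w = rad (fun p => if (p < n)%N then c p else 0) w.
Proof.
rewrite /span_elt /rad; under eq_bigr do rewrite s0powE.
case: ltnP => [wn|nw].
  rewrite (bigD1 (Ordinal wn))//= eqxx big1 ?addr0// => i /negbTE iw.
  by rewrite eq_sym (_ : (_ == _) = false) ?mulr0//; rewrite -[size w]/(val (Ordinal wn)) val_eqE.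
rewrite mul0r big1// => i _; rewrite gtn_eqF ?mulr0//.
exact: leq_trans (ltn_ord i) nw.
Qed.

(** Truncations of [c] are span elements, and the squared error is a tail of a convergent series. *)
Lemma in_HOmega_rad c : in_l2 (rad c) -> in_HOmega (rad c).
Proof.
move=> l2; split=> // eps eps0.
move: (l2); rewrite /in_l2 l2sq_rad => fin.
have := nneseries_tail_cvg fin (fun k _ => csq_ge0 (c k)).
move=> /fine_cvgP[+ /cvgrPdist_lt /(_ _ eps0)].
move=> [n1 _ H1] [n2 _ H2]; pose n := maxn n1 n2.
exists n, c.
have -> : (fun w => rad c w - span_elt n c w) =
    rad (fun p => if (p < n)%N then 0 else c p).
  apply/funext => w; rewrite span_eltE /rad -mulrBl; congr (_ * _).
  by case: ifP; rewrite ?subrr ?subr0.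
rewrite l2sq_rad (nneseries_split 0 n); last first.
  by move=> k _; rewrite lee_fin csq_ge0.
rewrite add0n big_nat big1 ?add0e; last first.
  by move=> i /andP[_ ->]; rewrite /csq /= expr0n addr0.
rewrite [ltLHS](_ : _ = (\sum_(n <= i <oo) (csq (c i))%:E)%E); last first.
  congr (limn _); apply/funext => m; apply: eq_big_nat => i /andP[ni _].
  by rewrite ltnNge ni.
have /H1 /= fn : (n1 <= n)%N by exact: leq_maxl.
have /H2 /= : (n2 <= n)%N by exact: leq_maxr.
rewrite sub0r normrN -lte_fin => h.
by rewrite -(fineK fn); apply: le_lt_trans h; rewrite lee_fin ler_norm.
Qed.

(** Span elements agree on words of equal length. Evaluation at a word is bounded by the norm, so
    limits of span elements agree there too. *)
Lemma in_HOmegaE v : in_HOmega v -> v = rad (coef v).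
Proof.
move=> [_ H]; apply/funext => w.
have lvl (u : vec R N) n (x : word N) : size x = n -> csq (u x) <= lvl_sq u n.
  move=> /eqP sx; rewrite /lvl_sq (bigD1 (Tuple sx))//= lerDl.
  by apply: sumr_ge0 => i _; exact: csq_ge0.
have lvl2 (u : vec R N) n (x : word N) : size x = n -> ((csq (u x))%:E <= l2sq u)%E.
  move=> sx; apply: (@le_trans _ _ (lvl_sq u n)%:E); first by rewrite lee_fin; exact: lvl.
  apply: le_trans (nneseries_lim_ge n.+1 _); last first.
    by move=> k _ _; rewrite lee_fin sumr_ge0// => i _; exact: csq_ge0.
  rewrite big_nat_recr//= leeDr// sume_ge0// => k _.
  by rewrite lee_fin sumr_ge0// => i _; exact: csq_ge0.
pose w' : word N := nseq (size w) (Ordinal hN).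
suff e : v w = v w'.
  by rewrite e /rad /coef mulrAC sqrtNX_invK mul1r.
apply/eqP; rewrite -subr_eq0; apply/eqP/csq_eq0/eqP.
rewrite eq_le csq_ge0 andbT; apply/ler_addgt0Pl => e e0.
(* The quarter comes from [csqB_le]: 2(e/4 + e/4) = e. *)
have e4 : 0 < e / 4 by lra.
have [n [c Hc]] := H _ e4; rewrite addr0.
pose u := fun w => v w - span_elt n c w.
have h1 : csq (u w) < e / 4.
  by rewrite -lte_fin; apply: le_lt_trans Hc; exact: lvl2.
have h2 : csq (u w') < e / 4.
  by rewrite -lte_fin; apply: le_lt_trans Hc; apply: (@lvl2 _ (size w)); rewrite size_nseq.
have -> : v w - v w' = u w - u w'.
  by rewrite /u !span_eltE /rad size_nseq; ring.
apply: le_trans (csqB_le _ _) _; lra.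
Qed.

(** The N children contribute N N^(-1/2) = sqrt N, and passing to the parent gains a factor sqrt N.
    The root has no parent, hence [N] on the diagonal and not [N + 1]. *)
Lemma lap_rad c : lap (rad c) = rad (fun n => if n is m.+1
  then (N%:R + 1) * c n - real_complex R sN * (c n.+1 + c m)
  else N%:R * c 0 - real_complex R sN * c 1).
Proof.
set z := real_complex R sN.
have zT : z * invsqrtN = 1 by have := sqrtNX_invK 1; rewrite !expr1.
have zz : N%:R = z * z :> C R by rewrite /z -rmorphM -expr2 sqr_sqrtN rmorph_nat.
apply/funext => w; rewrite /lap.
under eq_bigr do rewrite /rad size_rcons.
rewrite sumr_const card_ord -[X in X + _]mulr_natl zz.
case: w => [|i w]; rewrite /rad/=.
  rewrite addr0 expr0 expr1 !mulr1.
  transitivity (z * z * c 0%N - z * c 1%N * (z * invsqrtN)); first by ring.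
  by rewrite zT mulr1.
rewrite /parent /rad /= size_takel; last exact: leqnSn.
set k := size w; rewrite !exprS; set t := invsqrtN ^+ k.
(* The two sides differ by a multiple of [z * invsqrtN - 1], which is zero. *)
transitivity (((z * z + 1) * c k.+1 - z * (c k.+2 + c k)) * (invsqrtN * t)
  + (c k * t - z * c k.+2 * invsqrtN * t) * (z * invsqrtN - 1)); first by ring.
by rewrite zT subrr mulr0 addr0.
Qed.

End Radial.

(** * The weighted L2 space *)

Section WeightedL2.
Variables (R : realType) (N : nat).
Hypothesis hN : (1 <= N)%N.

Notation mu := (@lebesgue_measure R).
Notation D := (`[(-1 : R), 1] : set R).
Notation sN := (Num.sqrt (N%:R : R)).
Notation r := (sN^-1).
Notation sqint := (sqint mu D).
Notation ip := (ip mu D).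
Implicit Types (f g : R -> R) (F G : R -> C R) (v : vec R N).

Let mD : @measurable _ (measurableTypeR R) D. Proof. exact: measurable_itv. Qed.

Let r01 : 0 < r <= 1.
Proof.
rewrite invr_gt0 sqrtN_gt0//= invf_le1 ?sqrtN_gt0//.
by rewrite -{1}[1]sqrtr1 ler_wsqrtr// ler1n.
Qed.

Lemma rhoE : rho N = wgt r.
Proof. by apply/funext => x; rewrite /rho /wgt /den exprVn sqr_sqrtN. Qed.

Lemma rho_ge0 x : D x -> 0 <= rho N x.
Proof. by rewrite rhoE; exact: wgt_ge0. Qed.

Lemma rho_gt0_ae : {ae mu, forall x, D x -> 0 < rho N x}.
Proof.
exists [set -1; 1]; split; first by apply: measurableU.
  by apply: null_set_setU => //; exact: lebesgue_measure_set1.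
apply: subsetCl => x /= /not_orP[/eqP xN1 /eqP x1] Dx.
rewrite rhoE /wgt; move: Dx (r01); rewrite in_itv/= => /andP[x0 x2] /andP[r0 r1].
have {}x0 : -1 < x by rewrite lt_neqAle eq_sym xN1.
have {}x2 : x < 1 by rewrite lt_neqAle x1.
rewrite divr_gt0//; last by rewrite /den; nra.
by rewrite /semicircle mulr_gt0 ?divr_gt0 ?pi_gt0// sqrtr_gt0; nra.
Qed.

(** The square root of the weight is absorbed here, so that the weighted problem becomes one for
    Lebesgue measure on [D]. *)
Definition phi (n : nat) (x : R) : R := (jac r n).[x] * Num.sqrt (rho N x).

Lemma measurable_sqrt_rho : measurable_fun D (fun x => Num.sqrt (rho N x)).
Proof.
apply: measurableT_comp; last by rewrite rhoE; exact: measurable_wgt.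
by apply: continuous_measurable_fun; exact: sqrt_continuous.
Qed.

Let integrable_rho : mu.-integrable D (EFin \o rho N).
Proof. by rewrite rhoE; exact: integrable_wgt. Qed.

Lemma phi_orthonormal : orthonormal mu D phi.
Proof.
split=> [n|m n].
  split.
    by apply: measurable_funM; [exact: measurable_horner|exact: measurable_sqrt_rho].
  apply: eq_integrable (integrable_horner (jac r n ^+ 2) integrable_rho) => // x.
  by rewrite inE => Dx /=; rewrite exprMn sqr_sqrtr ?rho_ge0// horner_exp.
rewrite -(jac_orthonormal (v := rho N) (s := r))//.
- apply: eq_Rintegral => x; rewrite inE => Dx.
  by rewrite /phi mulrACA -expr2 sqr_sqrtr ?rho_ge0// hornerM.
- by rewrite rhoE; have := moment_wgt 0 r01.
- by move=> k; rewrite rhoE moment_wgt.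
Qed.

Lemma sqint_phi n : sqint (phi n). Proof. exact: phi_orthonormal.1. Qed.

Lemma phi_total f : sqint f -> (forall n, ip f (phi n) = 0) ->
  {ae mu, forall x, D x -> f x = 0}.
Proof.
move=> sf f0; pose h x := f x * Num.sqrt (rho N x).
have ih : mu.-integrable D (EFin \o h).
  (* [phi 0] is the square root of [rho], so [h] is a product of two square-integrable functions. *)
  have := sqintM mD sf (sqint_phi 0); apply: eq_integrable => // x _ /=.
  by rewrite /phi jac0 (hornerC 1) mul1r.
have h0 : forall p : {poly R}, \int[mu]_(x in D) (p.[x] * h x) = 0.
  apply: (jac_total (s := r)) => // n; rewrite -[RHS](f0 n).
  by apply: eq_Rintegral => x _; rewrite /h /phi mulrCA.
have := poly_total ih h0; have := rho_gt0_ae.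
apply: filterS2 => [|x rx hx Dx]; first exact: (ae_filter_ringOfSetsType mu).
have := hx Dx => /= -[] /eqP.
rewrite mulf_eq0 => /orP[/eqP//|].
by rewrite sqrtr_eq0 leNgt rx.
Qed.

(** * Complex functions by real and imaginary parts *)

Definition wRe F x : R := complex.Re (F x) * Num.sqrt (rho N x).
Definition wIm F x : R := complex.Im (F x) * Num.sqrt (rho N x).
Definition ccoef F n : C R := Complex (ip (wRe F) (phi n)) (ip (wIm F) (phi n)).

Definition cmeasurable F := measurable_fun D (fun x => complex.Re (F x)) /\
  measurable_fun D (fun x => complex.Im (F x)).

Lemma L2sqE F : cmeasurable F -> L2sq N F =
  (\int[mu]_(x in D) (wRe F x ^+ 2)%:E + \int[mu]_(x in D) (wIm F x ^+ 2)%:E)%E.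
Proof.
move=> [mR mI]; have ms := measurable_sqrt_rho.
rewrite -ge0_integralD//.
- apply: eq_integral => x; rewrite inE => Dx; rewrite -EFinD; congr EFin.
  by rewrite /csq /wRe /wIm !exprMn sqr_sqrtr ?rho_ge0// mulrDl.
- by move=> x _; rewrite lee_fin sqr_ge0.
- by apply/measurable_EFinP/measurable_funX/measurable_funM.
- by move=> x _; rewrite lee_fin sqr_ge0.
- by apply/measurable_EFinP/measurable_funX/measurable_funM.
Qed.

Lemma in_L2P F : in_L2 N F <-> [/\ cmeasurable F, sqint (wRe F) & sqint (wIm F)].
Proof.
have ms := measurable_sqrt_rho.
split=> [[mR [mI fin]]|[mF sR sI]].
  have mF : cmeasurable F by split.
  have a0 (f : R -> R) : (0 <= \int[mu]_(x in D) (f x ^+ 2)%:E)%E.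
    by apply: integral_ge0 => x _; rewrite lee_fin sqr_ge0.
  have sq f : measurable_fun D f ->
      (\int[mu]_(x in D) (f x ^+ 2)%:E < +oo)%E -> sqint f.
    move=> mf ff; split => //; apply/integrableP; split.
      by apply/measurable_EFinP/measurable_funX.
    by under eq_integral => x _ do rewrite gee0_abs ?lee_fin ?sqr_ge0//.
  move: fin; rewrite L2sqE// => fin; split => //; apply: sq.
  - exact: measurable_funM.
  - by apply: le_lt_trans fin; rewrite leeDl.
  - exact: measurable_funM.
  - by apply: le_lt_trans fin; rewrite leeDr.
case: (mF) => mR mI; split => //; split => //.
by rewrite L2sqE// !ip_integral// -EFinD ltry.
Qed.

Lemma L2sq_ip F : in_L2 N F -> L2sq N F = (ip (wRe F) (wRe F) + ip (wIm F) (wIm F))%:E.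
Proof. by move=> /in_L2P[mF sR sI]; rewrite L2sqE// !ip_integral. Qed.

Lemma L2eq_ccoef F G : in_L2 N F -> in_L2 N G ->
  (forall n, ccoef F n = ccoef G n) -> L2eq N F G.
Proof.
move=> /in_L2P[[mFR mFI] sFR sFI] /in_L2P[[mGR mGI] sGR sGI] e.
have ReB x : wRe (fun x => F x - G x) x = wRe F x - wRe G x.
  by rewrite /wRe -mulrBl; case: (F x) (G x) => [? ?] [? ?].
have ImB x : wIm (fun x => F x - G x) x = wIm F x - wIm G x.
  by rewrite /wIm -mulrBl; case: (F x) (G x) => [? ?] [? ?].
have mB : cmeasurable (fun x => F x - G x).
  split.
    rewrite (_ : (fun x => _) = fun x => complex.Re (F x) - complex.Re (G x)).
      exact: measurable_funB.
    by apply/funext => x; case: (F x) (G x) => [? ?] [? ?].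
  rewrite (_ : (fun x => _) = fun x => complex.Im (F x) - complex.Im (G x)).
    exact: measurable_funB.
  by apply/funext => x; case: (F x) (G x) => [? ?] [? ?].
have zero f g : sqint f -> sqint g -> (forall n, ip f (phi n) = ip g (phi n)) ->
    (\int[mu]_(x in D) ((f x - g x) ^+ 2)%:E = 0)%E.
  move=> sf sg fg; have sB := sqintB mD sf sg.
  have := @phi_total _ sB => /(_ _) ae0.
  rewrite (ge0_ae_eq_integral (g := cst 0%E))//.
  - by rewrite integral0.
  - by apply/measurable_EFinP/measurable_funX; case: sB.
  - by move=> x _; rewrite lee_fin sqr_ge0.
  - apply: filterS (ae0 _) => [|x /[apply] ->|n]; last 2 first.
    + by rewrite expr0n.
    + by rewrite ipB// ?fg ?subrr//; exact: sqint_phi.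
    exact: (ae_filter_ringOfSetsType mu).
rewrite /L2eq L2sqE//.
under eq_integral do rewrite ReB.
under [X in (_ + X)%E]eq_integral do rewrite ImB.
by rewrite !zero ?adde0// => n; case: (e n).
Qed.

End WeightedL2.

(** * The unitary equivalence *)

Section Equivalence.
Variables (R : realType) (N : nat).
Hypothesis hN : (1 <= N)%N.

Notation mu := (@lebesgue_measure R).
Notation D := (`[(-1 : R), 1] : set R).
Notation sN := (Num.sqrt (N%:R : R)).
Notation r := (sN^-1).
Notation sqint := (sqint mu D).
Notation ip := (ip mu D).
Notation phi := (@phi R N).
Implicit Types (f g : R -> R) (F G : R -> C R) (v : vec R N).

Let mD : @measurable _ (measurableTypeR R) D. Proof. exact: measurable_itv. Qed.

Let muD : (mu D < +oo)%E.
Proof. by rewrite lebesgue_measure_itv/= lte_fin; case: ifP => _; rewrite ?ltry. Qed.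

Let sqphi n : sqint (phi n). Proof. exact: sqint_phi. Qed.

Lemma in_HOmega_ccoef F : in_L2 N F -> in_HOmega (rad (N := N) (ccoef N F)).
Proof.
move=> /(in_L2P hN)[_ sR sI]; apply: in_HOmega_rad => //; rewrite /in_l2 l2sq_rad//.
apply: (@le_lt_trans _ _ (ip (wRe N F) (wRe N F) + ip (wIm N F) (wIm N F))%:E);
  last exact: ltry.
apply: lime_le.
  by apply: is_cvg_nneseries => n _ _; rewrite lee_fin csq_ge0.
apply: nearW => n; rewrite sumEFin lee_fin big_mkord.
rewrite /csq /ccoef/= big_split/=; apply: lerD.
- exact: (bessel (mu := mu) mD (phi_orthonormal R hN) n sR).
- exact: (bessel (mu := mu) mD (phi_orthonormal R hN) n sI).
Qed.

(** Riesz-Fischer works in unweighted L^2; division by the root of [rho] leads back. Where the root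
    is 0 the product is 0 instead of [f x], but every [phi n] vanishes there as well, and the set is
    null. *)
Lemma divsqrt_spec f : sqint f ->
  let g x := f x / Num.sqrt (rho N x) * Num.sqrt (rho N x) in
  [/\ sqint g, forall n, ip g (phi n) = ip f (phi n) & ip g g = ip f f].
Proof.
move=> sf; have [mf f2] := sf.
have ms := @measurable_sqrt_rho R N.
pose g x := f x / Num.sqrt (rho N x) * Num.sqrt (rho N x).
have gE x : g x = if Num.sqrt (rho N x) == 0 then 0 else f x.
  by rewrite /g; case: eqVneq => [->|?]; rewrite ?mulr0// divfK.
have mg : measurable_fun D g.
  apply: measurable_funM => //; apply: measurable_funM => //.
  exact: measurableT_comp (@measurable_inv R) ms.
have sg : sqint g.
  split => //; apply: (@le_integrable _ _ _ mu D mD _ (EFin \o (fun x => f x ^+ 2))) => //.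
    by apply/measurable_EFinP/measurable_funX.
  move=> x _ /=; rewrite lee_fin gE; case: ifP => // _.
  by rewrite expr0n normr0.
split => //.
  move=> n; apply: eq_Rintegral => x _; rewrite -/(g x) gE /phi.
  by case: eqVneq => [->|//]; rewrite !mulr0.
apply: EFin_inj; rewrite -!(ip_integral (mu := mu))//.
apply: ge0_ae_eq_integral => //.
- by apply/measurable_EFinP/measurable_funX.
- by apply/measurable_EFinP/measurable_funX.
- by move=> x _; rewrite lee_fin sqr_ge0.
- by move=> x _; rewrite lee_fin sqr_ge0.
apply: filterS (rho_gt0_ae R hN) => [|x rx Dx]; first exact: (ae_filter_ringOfSetsType mu).
by rewrite -/(g x) gE sqrtr_eq0 leNgt rx.
Qed.

Lemma eseries_EFin (a : nat -> R) l : (fun n => \sum_(i < n) a i) @ \oo --> l ->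
  (\sum_(0 <= n <oo) (a n)%:E = l%:E)%E.
Proof.
move=> al; apply/cvg_lim => //; apply: cvg_EFin.
  by apply: nearW => n; rewrite sumEFin.
rewrite (_ : fine \o _ = fun n => \sum_(i < n) a i)//.
by apply/funext => n /=; rewrite sumEFin/= big_mkord.
Qed.

Lemma transform_exists v : in_HOmega v -> exists F,
  [/\ in_L2 N F, forall n, ccoef N F n = coef hN v n & L2sq N F = l2sq v].
Proof.
move=> Hv; have vE := in_HOmegaE hN Hv; set c := coef hN v in vE *.
have [+ _] := Hv; rewrite /in_l2 {1}vE l2sq_rad// => fin.
have cv (a : nat -> R) : (forall n, 0 <= a n <= csq (c n)) ->
    exists l : R, (fun n => \sum_(i < n) a i) @ \oo --> l.
  move=> ac; pose sa n := \sum_(i < n) a i; suff h : cvgn sa by exists (limn sa).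
  apply: nondecreasing_is_cvgn.
    apply/nondecreasing_seqP => n; rewrite /sa big_ord_recr/= lerDl.
    by case/andP: (ac n).
  exists (fine (\sum_(0 <= n <oo) (csq (c n))%:E)%E) => _ [n _ <-].
  rewrite -lee_fin fineK; last first.
    by rewrite ge0_fin_numE// nneseries_ge0// => k _ _; rewrite lee_fin csq_ge0.
  apply: le_trans (nneseries_lim_ge n _); last first.
    by move=> k _ _; rewrite lee_fin csq_ge0.
  rewrite sumEFin big_mkord lee_fin; apply: ler_sum => i _.
  by case/andP: (ac i).
have [n|l1 c1] := cv (fun n => complex.Re (c n) ^+ 2).
  by rewrite sqr_ge0 /csq lerDl sqr_ge0.
have [n|l2 c2] := cv (fun n => complex.Im (c n) ^+ 2).
  by rewrite sqr_ge0 /csq lerDr sqr_ge0.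
have [f [sf fc ff]] := riesz_fischer (mu := mu) mD muD (phi_orthonormal R hN)
    (c := fun n => complex.Re (c n)) c1.
have [g [sg gc gg]] := riesz_fischer (mu := mu) mD muD (phi_orthonormal R hN)
    (c := fun n => complex.Im (c n)) c2.
have [sf' fc' ff'] := divsqrt_spec sf.
have [sg' gc' gg'] := divsqrt_spec sg.
pose F x : C R := Complex (f x / Num.sqrt (rho N x)) (g x / Num.sqrt (rho N x)).
have mi : measurable_fun D (fun x => (Num.sqrt (rho N x))^-1).
  exact: measurableT_comp (@measurable_inv R) (@measurable_sqrt_rho R N).
have FL : in_L2 N F.
  apply/(in_L2P hN); split => //; split.
    by apply: measurable_funM => //; case: sf.
  by apply: measurable_funM => //; case: sg.
exists F; split => // [n|].
  rewrite /ccoef fc' gc' fc gc; by case: (c n).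
rewrite L2sq_ip// ff' gg' ff gg vE l2sq_rad//.
transitivity ((\sum_(0 <= n <oo) (complex.Re (c n) ^+ 2)%:E) +
  (\sum_(0 <= n <oo) (complex.Im (c n) ^+ 2)%:E))%E.
  by rewrite (eseries_EFin c1) (eseries_EFin c2).
rewrite -nneseriesD.
- by apply: eq_eseriesr.
- by move=> i _ _; rewrite lee_fin sqr_ge0.
- by move=> i _ _; rewrite lee_fin sqr_ge0.
Qed.

Lemma in_L2_lin a F G : in_L2 N F -> in_L2 N G ->
  in_L2 N (fun x => a * F x + G x) /\
  forall n, ccoef N (fun x => a * F x + G x) n = a * ccoef N F n + ccoef N G n.
Proof.
case: a => a b /(in_L2P hN)[[mFR mFI] sFR sFI] /(in_L2P hN)[[mGR mGI] sGR sGI].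
set H := fun x => _.
have ReH x : complex.Re (H x) =
    a * complex.Re (F x) + (- b * complex.Im (F x) + complex.Re (G x)).
  by rewrite /H; case: (F x) (G x) => [? ?] [? ?] /=; ring.
have ImH x : complex.Im (H x) =
    a * complex.Im (F x) + (b * complex.Re (F x) + complex.Im (G x)).
  by rewrite /H; case: (F x) (G x) => [? ?] [? ?] /=; ring.
have wReH : wRe N H = (fun x => a * wRe N F x + (- b * wIm N F x + wRe N G x)).
  by apply/funext => x; rewrite /wRe ReH /wIm; ring.
have wImH : wIm N H = (fun x => a * wIm N F x + (b * wRe N F x + wIm N G x)).
  by apply/funext => x; rewrite /wIm ImH /wRe; ring.
have s1 := sqint_lin mD (- b) sFI sGR; have s2 := sqint_lin mD b sFR sGI.
split.
  apply/(in_L2P hN); rewrite wReH wImH; split; try exact: sqint_lin.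
  split; [rewrite (funext ReH)|rewrite (funext ImH)].
    by apply: measurable_funD; [|apply: measurable_funD => //];
      exact: measurable_funM.
  by apply: measurable_funD; [|apply: measurable_funD => //];
    exact: measurable_funM.
move=> n; rewrite /ccoef wReH wImH !ip_lin//.
by apply/eqP; rewrite eq_complex/=; apply/andP; split; apply/eqP; ring.
Qed.

(** This is sqrt N times the recurrence 2x P_n = P_(n+1) + P_(n-1). For n = 0 the term r P_0
    contributes sqrt N r = 1 and lowers [N + 1] to [N], as at the root in [lap_rad]. *)
Lemma mulop_phi n x : (N%:R + 1 - 2 * sN * x) * phi n x =
  if n is m.+1 then (N%:R + 1) * phi n x + - sN * (phi n.+1 x + phi m x)
  else N%:R * phi 0 x + - sN * phi 1 x.
Proof.
have s0 : sN != 0 by rewrite gt_eqF// sqrtN_gt0.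
case: n => [|n].
  have := congr1 (fun p => p.[x]) (mulX_jac0 r).
  rewrite hornerM hornerD !hornerZ hornerX => e.
  rewrite /phi; set t := Num.sqrt (rho N x).
  transitivity ((N%:R + 1) * (jac r 0).[x] * t - sN * (2 * x * (jac r 0).[x]) * t);
    first by ring.
  by rewrite e; field.
have := congr1 (fun p => p.[x]) (mulX_jacS r n).
rewrite hornerM hornerD !hornerZ hornerX => e.
rewrite /phi; set t := Num.sqrt (rho N x).
transitivity ((N%:R + 1) * (jac r n.+1).[x] * t - sN * (2 * x * (jac r n.+1).[x]) * t);
  first by ring.
by rewrite e; ring.
Qed.

Lemma ip_mulop f n : sqint f ->
  ip (fun x => (N%:R + 1 - 2 * sN * x) * f x) (phi n) =
  if n is m.+1 then (N%:R + 1) * ip f (phi n) - sN * (ip f (phi n.+1) + ip f (phi m))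
  else N%:R * ip f (phi 0) - sN * ip f (phi 1).
Proof.
move=> sf.
transitivity (ip f (fun x => (N%:R + 1 - 2 * sN * x) * phi n x)).
  by apply: eq_Rintegral => x _; ring.
under [X in ip f X]eq_fun do rewrite mulop_phi.
case: n => [|n].
  by rewrite ipC ip_lin ?ipZ// 1?ipC ?[ip (phi 1) _]ipC ?mulNr//; exact: sqintZ.
rewrite ipC ip_lin//; last by apply: sqintZ => //; exact: sqintD.
rewrite ipZ//; last exact: sqintD.
by rewrite ipD// ![ip _ f]ipC mulNr.
Qed.

(** The coefficient formula has exactly the shape of [lap_rad], which yields the intertwining
    relation by rewriting. *)
Lemma in_L2_mulop F : in_L2 N F -> in_L2 N (mulop N F) /\
  ccoef N (mulop N F) = fun n => if n is m.+1
    then (N%:R + 1) * ccoef N F n - real_complex R sN * (ccoef N F n.+1 + ccoef N F m)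
    else N%:R * ccoef N F 0 - real_complex R sN * ccoef N F 1.
Proof.
move=> /(in_L2P hN)[[mR mI] sR sI].
pose m : {poly R} := (N%:R + 1)%:P - (2 * sN) *: 'X.
have mE x : N%:R + 1 - 2 * sN * x = m.[x] by rewrite /m !hornerE.
have ReM x : complex.Re (mulop N F x) = m.[x] * complex.Re (F x).
  by rewrite -mE /mulop; case: (F x) => a b /=; ring.
have ImM x : complex.Im (mulop N F x) = m.[x] * complex.Im (F x).
  by rewrite -mE /mulop; case: (F x) => a b /=; ring.
have wR : wRe N (mulop N F) = fun x => m.[x] * wRe N F x.
  by apply/funext => x; rewrite /wRe ReM mulrA.
have wI : wIm N (mulop N F) = fun x => m.[x] * wIm N F x.
  by apply/funext => x; rewrite /wIm ImM mulrA.
have mm := measurable_horner m.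
have sm f : sqint f -> sqint (fun x => m.[x] * f x).
  move=> [mf f2]; split; first exact: measurable_funM.
  apply: eq_integrable (integrable_horner (m ^+ 2) f2) => // x _ /=.
  by rewrite horner_exp exprMn.
split.
  apply/(in_L2P hN); rewrite wR wI; split; [|exact: sm|exact: sm].
  split; [rewrite (funext ReM)|rewrite (funext ImM)];
    exact: measurable_funM.
apply/funext => n; rewrite /ccoef wR wI.
have mf f : (fun x => m.[x] * f x) = (fun x => (N%:R + 1 - 2 * sN * x) * f x).
  by apply/funext => x; rewrite mE.
rewrite !mf !ip_mulop//.
have -> : N%:R = real_complex R N%:R :> C R by rewrite rmorph_nat.
by case: n => [|n]; apply/eqP; rewrite eq_complex/=;
  apply/andP; split; apply/eqP; ring.
Qed.

End Equivalence.

(* The restriction of Delta (= W Delta W^* read in the word basis) to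
   H_Omega is unitarily equivalent to multiplication by N+1-2 sqrt(N) x on
   L^2(mu_{c+p}): H_Omega is Delta-invariant and there is a linear,
   norm-preserving, surjective map U : H_Omega -> L^2(mu_{c+p})
   intertwining Delta with the multiplication operator. *)
Theorem theorem3p21 (R : realType) (N : nat) (hN : (1 <= N)%N) :
  exists U : vec R N -> (R -> C R),
    (forall v, in_HOmega v -> in_L2 N (U v)) /\
    (forall (a : C R) (v w : vec R N), in_HOmega v -> in_HOmega w ->
       L2eq N (U (fun t => a * v t + w t)) (fun x => a * U v x + U w x)) /\
    (forall v, in_HOmega v -> L2sq N (U v) = l2sq v) /\
    (forall g, in_L2 N g -> exists v, in_HOmega v /\ L2eq N (U v) g) /\
    (forall v, in_HOmega v ->
       in_HOmega (lap v) /\ L2eq N (U (lap v)) (mulop N (U v))).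
Proof.
(* [U] must be total; outside H_Omega its value is an arbitrary default. *)
have ex (v : vec R N) : exists F, in_HOmega v -> [/\ in_L2 N F,
    forall n, ccoef N F n = coef hN v n & L2sq N F = l2sq v].
  have [Hv|Hv] := pselect (in_HOmega v); last by exists (fun=> 0).
  by have [F HF] := transform_exists hN Hv; exists F.
have [U HU] := choice ex.
(* A function with prescribed coefficients both puts the radial vector in
   H_Omega (Bessel) and identifies its transform (completeness). *)
have UE F v : in_L2 N F -> v = rad (ccoef N F) -> in_HOmega v /\ L2eq N (U v) F.
  move=> FL ->; have Hv := in_HOmega_ccoef hN FL; split => //.
  have [UL Uc _] := HU _ Hv.
  by apply: (L2eq_ccoef hN) => // n; rewrite Uc coef_rad.
have radU v : in_HOmega v -> v = rad (ccoef N (U v)).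
  move=> Hv; have [_ Uc _] := HU v Hv; rewrite {1}(in_HOmegaE hN Hv).
  by congr rad; apply/funext => n; rewrite Uc.
exists U; split; [|split; [|split; [|split]]].
- by move=> v /HU[].
- move=> a v w Hv Hw; have [UvL _ _] := HU v Hv; have [UwL _ _] := HU w Hw.
  have [L c] := in_L2_lin hN a UvL UwL; apply: (UE _ _ L _).2.
  apply/funext => t; rewrite {1}(radU v Hv) {1}(radU w Hw) /rad c; ring.
- by move=> v /HU[].
- by move=> g gL; exists (rad (ccoef N g)); apply: UE.
(* [UE] at [mulop N (U v)] gives both the invariance of H_Omega and the intertwining relation. *)
- move=> v Hv; have [UvL _ _] := HU v Hv.
  have [L c] := in_L2_mulop hN UvL; apply: UE => //.
  by rewrite c {1}(radU v Hv) lap_rad.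
Qed.
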